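(* Let $\mathbb{K}$ be a field and let $A = A_0 + A_1 x_1 + \cdots + A_m x_m$ be a square linear matrix over $\mathbb{K}(t)$, i.e., $A_0,A_1,\ldots,A_m\in\mathbb{K}(t)^{n\times n}$. If $A_1,A_2,\ldots,A_m$ are rank-$1$ matrices (over $\mathbb{K}(t)$), then $\deg\det A = \deg\operatorname{Det} A$.
   Context: In $\deg\det A$, the variables $x_1,\ldots,x_m$ are commuting indeterminates, $A$ is regarded as a matrix over the field $\mathbb{K}(x_1,\ldots,x_m)(t)$, $\det$ is the ordinary determinant and $\deg$ is the degree in $t$ ($\deg(p/q)=\deg p-\deg q$, $\deg 0=-\infty$). In $\deg\operatorname{Det} A$, the variables are pairwise non-commutative and $A$ is regarded as a matrix over $\mathbb{F}(t)$, where $\mathbb{F}=\mathbb{K}(\langle x_1,\ldots,x_m\rangle)$ is the free skew field (universal skew field of fractions of the free ring $\mathbb{K}\langle x_1,\ldots,x_m\rangle$), and $\mathbb{F}(t)$ is the skew field of fractions of the polynomial ring $\mathbb{F}[t]$, where $t$ commutes with $\mathbb{F}$; $\deg(p/q):=\deg p-\deg q$. $\operatorname{Det}$ is the Dieudonné determinant: a nonsingular matrix $A$ over a skew field $\mathbb{D}$ can be written $A=LDPU$ with $L$ lower-unitriangular, $D$ diagonal with nonzero diagonals $d_1,\dots,d_n$, $P$ a permutation matrix, $U$ upper-unitriangular ($DP$ unique), and $\operatorname{Det}A:=\operatorname{sgn}(P)d_1\cdots d_n$ modulo $[\mathbb{D}^\times,\mathbb{D}^\times]$. For $\mathbb{D}=\mathbb{F}(t)$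 its degree is well-defined; $\deg\operatorname{Det}A:=-\infty$ if $A$ is singular. *)

(* Defs.v *)
From HB Require Import structures.
From mathcomp Require Import all_boot all_order all_fingroup all_algebra.
From mathcomp Require Import monalg mpoly.
From Stdlib Require Import ClassicalEpsilon.

Set Implicit Arguments.
Unset Strict Implicit.
Unset Printing Implicit Defensive.

Import GRing.Theory.
Local Open Scope ring_scope.

(** [GRing.field_axiom D] says that all nonzero elements of the [unitRingType]
    [D] are invertible; since [unitRingType]s need not be commutative, it
    expresses that [D] is a skew field. *)

(** ** Universal skew fields of fractions (P. M. Cohn)

    An epic [R]-field is a ring morphism from [R] to a skew field that is
    generated, as a skew field, by the image of [R].  A specialization between
    two epic [R]-fields [F] and [E] is a morphism [phi] over [R] to [E] from a
    subring [S] of [F] containing the image of [R], such that the elements of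
    [S] outside of the kernel are invertible in [S].  An epic [R]-field is
    universal if it has a specialization to every epic [R]-field (unique, up
    to the choice of [S], by epicness), and it is a field of fractions of [R]
    if [R] embeds into it.  Subrings and skew subfields are boolean predicates,
    which is no restriction classically. *)

Definition epic_field (R : nzRingType) (F : unitRingType) (f : R -> F) : Prop :=
  GRing.field_axiom F /\
  forall S : {pred F}, divring_closed S -> (forall r, f r \in S) ->
    forall x, x \in S.

(** [phi] is only meaningful on [S]. *)
Record is_specialization (R : nzRingType) (F E : unitRingType)
    (f : R -> F) (g : R -> E) (S : {pred F}) (phi : F -> E) : Prop := {
  spec_subring : subring_closed S;
  spec_base : forall r, f r \in S;
  specB : {in S &, {morph phi : x y / x - y}};
  specM : {in S &, {morph phi : x y / x * y}};
  spec_over : forall r, phi (f r) = g r;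
  spec_local : {in S, forall x, phi x != 0 -> x^-1 \in S}
}.

Record universal_field_of_fractions (R : nzRingType) (F : unitRingType)
    (f : {rmorphism R -> F}) : Prop := {
  uff_epic : epic_field f;
  uff_inj : injective f;
  uff_universal : forall (E : unitRingType) (g : {rmorphism R -> E}),
    epic_field g -> exists S phi, is_specialization f g S phi
}.

(** The free ring [K<x_1, ..., x_m>] is the monoid algebra of the free monoid
    on ['I_m]. *)
Definition free_ring (K : fieldType) (m : nat) : lalgType K :=
  {malg K[{fmonom 'I_m}]}.

Definition free_var (K : fieldType) (m : nat) (i : 'I_m) : free_ring K m :=
  (mkmalgU (fmu i) 1 : {malg K[{fmonom 'I_m}]}).

(** ** Rational functions in a central indeterminate [t]

    [skew_fractions j] says that [D], with the embedding [j], is [F(t)]; the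
    indeterminate of [{poly F}] commutes with the coefficients. *)

Record skew_fractions (F : nzRingType) (D : unitRingType)
    (j : {rmorphism {poly F} -> D}) : Prop := {
  sf_skew_field : GRing.field_axiom D;
  sf_inj : injective j;
  sf_surj : forall d : D, exists p q : {poly F}, q != 0 /\ d = j p / j q
}.

(** A pair [(p, q)] such that [d = p / q]. *)
Definition numden (F : nzRingType) (D : unitRingType) (j : {poly F} -> D)
    (d : D) : {poly F} * {poly F} :=
  epsilon (inhabits (0, 1)) (fun pq => pq.2 != 0 /\ d = j pq.1 / j pq.2).

(** [None] stands for minus infinity. *)
Definition degree := option int.

(** [deg (p / q) = deg p - deg q]; note that [size p] is [deg p + 1]. *)
Definition ratdeg (F : nzRingType) (D : unitRingType) (j : {poly F} -> D)
    (d : D) : degree :=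
  let: (p, q) := numden j d in
  if p == 0 then None else Some ((size p)%:Z - (size q)%:Z).

(** The embedding of [K(t)] into [D = F(t)] induced by [K -> R -> F]. *)
Definition ratemb (K : fieldType) (R : lalgType K) (F : nzRingType)
    (D : unitRingType) (f : R -> F) (j : {poly F} -> D)
    (a : {fraction {poly K}}) : D :=
  let: (p, q) := numden (@FracField.tofrac {poly K}) a in
  j (map_poly (fun c => f c%:A) p) / j (map_poly (fun c => f c%:A) q).

(** [A_0 + A_1 x_1 + ... + A_m x_m] as a matrix over [D = F(t)]. *)
Definition linear_mx (K : fieldType) (R : lalgType K) (F : nzRingType)
    (D : unitRingType) (f : R -> F) (j : {poly F} -> D) (m n : nat)
    (x : 'I_m -> R) (A0 : 'M[{fraction {poly K}}]_n)
    (A : 'I_m -> 'M[{fraction {poly K}}]_n) : 'M[D]_n :=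
  map_mx (ratemb f j) A0
  + \sum_(i < m) j (f (x i))%:P *: map_mx (ratemb f j) (A i).

(** ** The ordinary determinant, over [K(x_1, ..., x_m)(t)] *)

Definition deg_det (K : fieldType) (m n : nat)
    (A0 : 'M[{fraction {poly K}}]_n)
    (A : 'I_m -> 'M[{fraction {poly K}}]_n) : degree :=
  let f := @FracField.tofrac (mpoly m K) in
  let j := @FracField.tofrac {poly {fraction mpoly m K}} in
  ratdeg j (\det (linear_mx f j (fun i => 'X_i) A0 A)).

(** ** The Dieudonne determinant *)

Definition nonsingular (D : nzRingType) (n : nat) (M : 'M[D]_n) : Prop :=
  exists N : 'M[D]_n, M *m N = 1%:M /\ N *m M = 1%:M.

Definition lower_unitriangular (D : nzRingType) (n : nat) (L : 'M[D]_n) : Prop :=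
  forall i j : 'I_n, (i <= j)%N -> L i j = (i == j)%:R.

Definition upper_unitriangular (D : nzRingType) (n : nat) (U : 'M[D]_n) : Prop :=
  forall i j : 'I_n, (j <= i)%N -> U i j = (i == j)%:R.

(** The subgroup [[D^*, D^*]]: finite products of commutators suffice, the
    inverse of a commutator being a commutator. *)
Inductive commutator_subgroup (D : unitRingType) : D -> Prop :=
| CommOne : commutator_subgroup 1
| CommMul x y c : x \is a GRing.unit -> y \is a GRing.unit ->
    commutator_subgroup c -> commutator_subgroup (x * y * x^-1 * y^-1 * c).

(** [Det M] as a coset of [[D^*, D^*]]; it is empty if [M] is singular. *)
Definition Dieudonne_det (D : unitRingType) (n : nat) (M : 'M[D]_n) : D -> Prop :=
  fun e => exists (L U : 'M[D]_n) (d : 'rV[D]_n) (s : 'S_n) (c : D),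
    [/\ lower_unitriangular L, upper_unitriangular U,
        forall i, d 0 i != 0,
        M = L *m diag_mx d *m perm_mx s *m U &
        commutator_subgroup c /\ e = (-1) ^+ s * (\prod_(i < n) d 0 i) * c].

Definition deg_Dieudonne (F : nzRingType) (D : unitRingType)
    (j : {poly F} -> D) (n : nat) (M : 'M[D]_n) : degree :=
  if excluded_middle_informative (nonsingular M)
  then ratdeg j (epsilon (inhabits 0) (Dieudonne_det M)) else None.

(** [F] is the free skew field [K(<x_1, ..., x_m>)], via [f], and [D] is
    [F(t)], via [j]. *)
Definition deg_Det (K : fieldType) (m n : nat) (F D : unitRingType)
    (f : {rmorphism free_ring K m -> F}) (j : {rmorphism {poly F} -> D})
    (A0 : 'M[{fraction {poly K}}]_n)
    (A : 'I_m -> 'M[{fraction {poly K}}]_n) : degree :=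
  deg_Dieudonne j (linear_mx f j (@free_var K m) A0 A).

(* Main.v *)
(** Let [A = B + x u v], where [x] is the last variable and [u v] its rank-one
    coefficient, and put [y = - 1/x].  The bordered matrix [[y, v], [u, B]] has the
    Schur complements [A] and, when [B] is invertible, [y - v B^-1 u].  Since [x]
    does not occur in [B], no cancellation happens in the latter, whose degree is
    [max(0, deg (v B^-1 u))]; hence
      deg Det A = max (deg Det B, deg Det [[0, v], [u, B]]),
    which remains true when [B] is singular.  Both matrices on the right have
    rank-one coefficients and one variable less, so [deg Det A] is determined by
    determinants over [K(t)], in the same way over every skew field of coefficients
    in which the variables are generic.  This applies to the free field and to
    [K(x_1, ..., x_m)].  Genericity means that some endomorphism of the skew field
    moves [x] and fixes [K] and the other variables; it is induced by the
    involution [x |-> 1 - x].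

    That [deg Det] is well defined and multiplicative follows from the uniqueness
    of [D P] in [L D P U] and its behaviour under adjacent row swaps. *)

Require Import Defs.
From HB Require Import structures.
From mathcomp Require Import all_boot all_order all_fingroup all_algebra.
From mathcomp Require Import monalg mpoly.
From mathcomp Require Import zify.
From Stdlib Require Import ClassicalEpsilon.

Set Implicit Arguments.
Unset Strict Implicit.
Unset Printing Implicit Defensive.

Import GRing.Theory.
Local Open Scope ring_scope.

(** * Unitriangular matrices over a possibly noncommutative ring *)

Section Unitriangular.
Variable R : nzRingType.
Implicit Types n : nat.

Lemma lower_unitriangularM n (L L' : 'M[R]_n) :
  lower_unitriangular L -> lower_unitriangular L' ->
  lower_unitriangular (L *m L').
Proof.
move=> hL hL' i j le_ij; rewrite mxE (bigD1 i) //= hL // eqxx mul1r hL' //.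
rewrite big1 ?addr0 // => k neq_ki; case: (ltngtP k i) => [lt_ki|lt_ik|eq_ki].
- rewrite hL' ?(leq_trans (ltnW lt_ki)) // -val_eqE ltn_eqF ?mulr0 //.
  exact: leq_trans lt_ki le_ij.
- by rewrite hL 1?ltnW // eq_sym (negPf neq_ki) mul0r.
- by move: neq_ki; rewrite -val_eqE /= eq_ki eqxx.
Qed.

Lemma lower_unitriangular1 n : lower_unitriangular (1%:M : 'M[R]_n).
Proof. by move=> i j _; rewrite mxE. Qed.

(** Reverses the order of the indices. Conjugation by it is multiplicative and exchanges lower and
    upper unitriangular matrices; transposition would not do, since it does not reverse products
    over a noncommutative ring. *)
Definition rev_mx n : 'M[R]_n := perm_mx (perm (@rev_ord_inj n)).

Lemma rev_mxK n : rev_mx n *m rev_mx n = 1%:M.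
Proof.
rewrite -perm_mxM -perm_mx1; congr perm_mx; apply/permP => i.
by rewrite permM !permE rev_ordK.
Qed.

Lemma rev_mx_conj n (M : 'M[R]_n) i j :
  (rev_mx n *m M *m rev_mx n) i j = M (rev_ord i) (rev_ord j).
Proof.
rewrite /rev_mx -row_permE.
have -> : perm_mx (perm (@rev_ord_inj n)) = perm_mx (perm (@rev_ord_inj n))^-1 :> 'M[R]_n.
  congr perm_mx; apply/permP => k; apply: (@perm_inj _ (perm (@rev_ord_inj n))).
  by rewrite permKV !permE rev_ordK.
by rewrite -col_permE !mxE !permE.
Qed.

Lemma upper_rev_conj n (U : 'M[R]_n) :
  upper_unitriangular U -> lower_unitriangular (rev_mx n *m U *m rev_mx n).
Proof.
move=> hU i j le_ij; rewrite rev_mx_conj hU ?(inj_eq rev_ord_inj) //=.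
exact: leq_sub2l.
Qed.

Lemma lower_rev_conj n (L : 'M[R]_n) :
  lower_unitriangular L -> upper_unitriangular (rev_mx n *m L *m rev_mx n).
Proof.
move=> hL i j le_ji; rewrite rev_mx_conj hL ?(inj_eq rev_ord_inj) //=.
exact: leq_sub2l.
Qed.

Lemma rev_conjK n (M : 'M[R]_n) :
  rev_mx n *m (rev_mx n *m M *m rev_mx n) *m rev_mx n = M.
Proof. by rewrite !mulmxA rev_mxK mul1mx -mulmxA rev_mxK mulmx1. Qed.

Lemma rev_conjM n (M N : 'M[R]_n) :
  rev_mx n *m (M *m N) *m rev_mx n
  = (rev_mx n *m M *m rev_mx n) *m (rev_mx n *m N *m rev_mx n).
Proof.
by rewrite !mulmxA -[_ *m rev_mx n *m rev_mx n]mulmxA rev_mxK mulmx1.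
Qed.

Lemma upper_unitriangularM n (U U' : 'M[R]_n) :
  upper_unitriangular U -> upper_unitriangular U' ->
  upper_unitriangular (U *m U').
Proof.
move=> hU hU'; rewrite -[U *m U']rev_conjK (rev_conjM U).
by apply/lower_rev_conj/lower_unitriangularM; apply: upper_rev_conj.
Qed.

Lemma lower_block n (a : 'cV[R]_n) (L : 'M[R]_n) :
  lower_unitriangular L -> lower_unitriangular (block_mx (1%:M : 'M_1) 0 a L).
Proof.
move=> hL i j; rewrite -[i]splitK -[j]splitK.
case: (split i) => i'; case: (split j) => j' /=.
- by rewrite block_mxEul !ord1 !mxE eqxx.
- by rewrite block_mxEur mxE eq_lrshift.
- by rewrite ord1.
- by rewrite block_mxEdr !add1n ltnS eq_rshift => /hL ->.
Qed.

Lemma upper_block n (a : 'rV[R]_n) (U : 'M[R]_n) :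
  upper_unitriangular U -> upper_unitriangular (block_mx (1%:M : 'M_1) a 0 U).
Proof.
move=> hU i j; rewrite -[i]splitK -[j]splitK.
case: (split i) => i'; case: (split j) => j' /=.
- by rewrite block_mxEul !ord1 !mxE eqxx.
- by rewrite ord1.
- by rewrite block_mxEdl mxE eq_rlshift.
- by rewrite block_mxEdr !add1n ltnS eq_rshift => /hU ->.
Qed.

(** Induction on the size: if [L'] inverts the lower right block and [a] is the column below the
    corner, the inverse has the column [- L' a] and the block [L']. *)
Lemma lower_unitriangularV n (L : 'M[R]_n) : lower_unitriangular L ->
  exists L', [/\ lower_unitriangular L', L *m L' = 1%:M & L' *m L = 1%:M].
Proof.
elim: n L => [|n IHn] L hL.
  by exists 1%:M; split; [exact: lower_unitriangular1 | |]; apply/matrixP=> -[].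
have [|L' [hL' LL' L'L]] := IHn (drsubmx (L : 'M_(1 + n))).
  move=> i j le_ij; rewrite mxE mxE hL ?eq_rshift //.
rewrite -[L](@submxK _ 1 n 1 n).
have -> : ulsubmx (L : 'M_(1 + n)) = 1%:M.
  by apply/matrixP=> i j; rewrite !ord1 mxE mxE hL // mxE.
have -> : ursubmx (L : 'M_(1 + n)) = 0.
  by apply/matrixP=> i j; rewrite !ord1 mxE mxE hL // mxE -val_eqE.
exists (block_mx 1%:M 0 (- (L' *m dlsubmx (L : 'M_(1 + n)))) L'); split.
- exact: lower_block.
- rewrite [LHS](@mulmx_block _ 1 n 1 n 1 n) !mul1mx !mul0mx !mulmx0 !mulmx1 !addr0 add0r LL'.
  rewrite mulmxN mulmxA LL' mul1mx subrr.
  by rewrite -scalar_mx_block.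
- rewrite [LHS](@mulmx_block _ 1 n 1 n 1 n) !mul1mx !mul0mx !mulmx0 !mulmx1 !addr0 add0r L'L.
  by rewrite addNr -scalar_mx_block.
Qed.

Lemma upper_unitriangularV n (U : 'M[R]_n) : upper_unitriangular U ->
  exists U', [/\ upper_unitriangular U', U *m U' = 1%:M & U' *m U = 1%:M].
Proof.
move=> /upper_rev_conj/lower_unitriangularV [L' [/lower_rev_conj hL' LL' L'L]].
exists (rev_mx n *m L' *m rev_mx n); split=> //.
- by rewrite -[U]rev_conjK -rev_conjM LL' mulmx1 rev_mxK.
- by rewrite -[U]rev_conjK -rev_conjM L'L mulmx1 rev_mxK.
Qed.

End Unitriangular.

(** * Arithmetic in a skew field *)

Section SkewField.
Variables (D : unitRingType) (D_field : GRing.field_axiom D).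

Lemma skew_mulf_neq0 (x y : D) : x != 0 -> y != 0 -> x * y != 0.
Proof.
move=> /D_field ux /D_field uy; have: x * y \is a GRing.unit by rewrite unitrMr.
by apply: contraTneq => ->; rewrite unitr0.
Qed.

Lemma skew_invr_neq0 (x : D) : x != 0 -> x^-1 != 0.
Proof.
move=> /D_field ux; have: x^-1 \is a GRing.unit by rewrite unitrV.
by apply: contraTneq => ->; rewrite unitr0.
Qed.

Lemma skew_mulVf (x : D) : x != 0 -> x^-1 * x = 1.
Proof. by move=> /D_field; apply: mulVr. Qed.

Lemma skew_mulfV (x : D) : x != 0 -> x / x = 1.
Proof. by move=> /D_field; apply: mulrV. Qed.

End SkewField.

(** * Transvections, monomial matrices and adjacent swaps *)

Section Elementary.
Variables (R : nzRingType) (n : nat).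
Implicit Types (a b : 'I_n) (c : R).

Definition elem_mx a b c : 'M[R]_n := 1%:M + c *: delta_mx a b.

Lemma mul_elem_mx a b c (M : 'M[R]_n) i j :
  (elem_mx a b c *m M) i j = M i j + (c * M b j) *+ (i == a).
Proof.
rewrite mulmxDl mul1mx mxE -scalemxAl mxE; congr (_ + _).
rewrite mxE (bigD1 b) //= mxE eqxx andbT big1 ?addr0 => [|k neq_kb].
  by case: eqP; rewrite ?mul0r ?mulr0 ?mul1r.
by rewrite mxE (negPf neq_kb) andbF mul0r.
Qed.

Lemma elem_mxE a b c i j :
  elem_mx a b c i j = (i == j)%:R + c *+ ((i == a) && (j == b)).
Proof. by rewrite !mxE; case: andP; rewrite ?mulr1 ?mulr0. Qed.

Lemma lower_elem_mx a b c : (b < a)%N -> lower_unitriangular (elem_mx a b c).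
Proof.
move=> lt_ba i j le_ij; rewrite elem_mxE; case: andP; rewrite ?addr0 //.
by move=> [/eqP ia /eqP jb]; move: le_ij; rewrite ia jb leqNgt lt_ba.
Qed.

Lemma upper_elem_mx a b c : (a < b)%N -> upper_unitriangular (elem_mx a b c).
Proof.
move=> lt_ab i j le_ij; rewrite elem_mxE; case: andP; rewrite ?addr0 //.
by move=> [/eqP ia /eqP jb]; move: le_ij; rewrite ia jb leqNgt lt_ab.
Qed.

Lemma elem_mx0 a b : elem_mx a b 0 = 1%:M.
Proof. by rewrite /elem_mx scale0r addr0. Qed.

Lemma elem_mxK a b c : a != b -> elem_mx a b (- c) *m elem_mx a b c = 1%:M.
Proof.
move=> neq_ab; apply/matrixP => i j; rewrite mul_elem_mx !elem_mxE mxE.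
rewrite [b == a]eq_sym (negPf neq_ab) addr0 -addrA mulNr.
case: (i == a) => /=; last by rewrite !addr0.
by rewrite mulr1n [j == b]eq_sym; case: (b == j); rewrite ?mulr1 ?mulr0 ?oppr0 ?subrr !addr0.
Qed.

Lemma diag_perm_mxE (d : 'rV[R]_n) (s : 'S_n) i j :
  (diag_mx d *m perm_mx s) i j = d 0 i *+ (s i == j).
Proof. by rewrite mul_diag_mx !mxE mulr_natr. Qed.

Lemma mul_diag_perm_mx (d : 'rV[R]_n) (s : 'S_n) (M : 'M[R]_n) i j :
  (diag_mx d *m perm_mx s *m M) i j = d 0 i * M (s i) j.
Proof. by rewrite -mulmxA mul_diag_mx mxE -row_permE mxE. Qed.

Lemma mul_mx_diag_perm (d : 'rV[R]_n) (s : 'S_n) (M : 'M[R]_n) i j :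
  (M *m diag_mx d *m perm_mx s) i (s j) = M i j * d 0 j.
Proof. by rewrite -[s]invgK -col_permE mxE invgK permK mul_mx_diag mxE. Qed.

Lemma tperm_conj_mxE a b (M : 'M[R]_n) i j :
  (tperm_mx a b *m M *m tperm_mx a b) i j = M (tperm a b i) (tperm a b j).
Proof. by rewrite /tperm_mx -row_permE -{2}[tperm a b]tpermV -col_permE !mxE. Qed.

Lemma tperm_mxK a b : tperm_mx a b *m tperm_mx a b = 1%:M :> 'M[R]_n.
Proof. by rewrite -perm_mxM tperm2 perm_mx1. Qed.

Lemma lower_tperm_conj a b (L : 'M[R]_n) : b = a.+1 :> nat ->
  lower_unitriangular L -> L b a = 0 ->
  lower_unitriangular (tperm_mx a b *m L *m tperm_mx a b).
Proof.
move=> ba hL Lba i j le_ij; rewrite tperm_conj_mxE.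
have [<-|neq_ij] := eqVneq i j; first by rewrite hL ?eqxx.
have neqt : tperm a b i != tperm a b j by rewrite (inj_eq perm_inj).
have lt_ij : (i < j)%N by rewrite ltn_neqAle le_ij andbT.
case: (leqP (tperm a b i) (tperm a b j)) => [le_t|lt_t].
  by rewrite hL // (negPf neqt).
suff [-> ->] : tperm a b i = b /\ tperm a b j = a by [].
move: lt_t lt_ij; case: tpermP => [->|->|/eqP ia /eqP ib];
  case: tpermP => [->|->|/eqP ja /eqP jb]; rewrite ?ba ?ltnn //; try lia.
Qed.

End Elementary.

(** * The degree read off an [L D P U] decomposition *)

Section Bruhat.
Variables (D : unitRingType) (dv : D -> int).
Hypothesis D_field : GRing.field_axiom D.
Hypothesis dvM : forall x y, x != 0 -> y != 0 -> dv (x * y) = dv x + dv y.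

Lemma dv1 : dv 1 = 0.
Proof.
have := dvM (oner_neq0 D) (oner_neq0 D); rewrite mulr1.
by move/(congr1 (fun x => x - dv 1)); rewrite subrr addrK.
Qed.

Lemma dvN1 : dv (-1) = 0.
Proof.
have h : (-1 : D) != 0 by rewrite oppr_eq0 oner_neq0.
by have := dvM h h; rewrite mulrNN mulr1 dv1; lia.
Qed.

Lemma dvN x : dv (- x) = dv x.
Proof.
have [->|x0] := eqVneq x 0; first by rewrite oppr0.
by rewrite -mulN1r dvM ?oppr_eq0 ?oner_neq0 // dvN1 add0r.
Qed.

Lemma dvV x : x != 0 -> dv x^-1 = - dv x.
Proof.
move=> x0; have := dvM x0 (skew_invr_neq0 D_field x0).
by rewrite skew_mulfV // dv1; lia.
Qed.

(** The degree of the Dieudonne determinant, as a relation: [dv] is additive, so it vanishes on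
    signs and commutators, and only the diagonal entries contribute. *)
Definition bruhat_degree n (M : 'M[D]_n) (w : int) : Prop :=
  exists (L : 'M[D]_n) (d : 'rV[D]_n) (s : 'S_n) (U : 'M[D]_n),
    [/\ lower_unitriangular L, upper_unitriangular U, forall i, d 0 i != 0,
        M = L *m diag_mx d *m perm_mx s *m U & w = \sum_i dv (d 0 i)].

(** Moving the unitriangular factors across gives [L'^-1 L D P = D' P' U' U^-1]. Its entry at
    [(i, s i)] is [d i] on the left, hence nonzero, and on the right it vanishes unless
    [s' i <= s i]. So [s = s'], and then [d = d']. *)
Lemma bruhat_degree_uniq n (M : 'M[D]_n) w w' :
  bruhat_degree M w -> bruhat_degree M w' -> w = w'.
Proof.
move=> [L [d [s [U [hL hU hd MLU ->]]]]] [L' [d' [s' [U' [hL' hU' hd' MLU' ->]]]]].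
have [X [hX L'X XL']] := lower_unitriangularV hL'.
have [Y [hY UY YU]] := upper_unitriangularV hU.
have E : X *m L *m diag_mx d *m perm_mx s
         = diag_mx d' *m perm_mx s' *m (U' *m Y).
  have: X *m M *m Y = X *m M *m Y by [].
  rewrite {1}MLU MLU' !mulmxA XL' mul1mx -!mulmxA UY.
  by rewrite mulmx1.
have Ed i : d 0 i = d' 0 i * (U' *m Y) (s' i) (s i).
  rewrite -mul_diag_perm_mx -E mul_mx_diag_perm.
  by rewrite (lower_unitriangularM hX hL) // eqxx mul1r.
have le_s i : (s' i <= s i)%N.
  rewrite leqNgt; apply/negP => lt_s; have := hd i.
  rewrite Ed (upper_unitriangularM hU' hY) 1?ltnW //.
  by rewrite -val_eqE gtn_eqF // mulr0 eqxx.
(* The values of two permutations have the same sum, so the pointwise inequality [le_s] is an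
   equality. *)
have eq_s i : s' i = s i.
  apply/val_inj/eqP; have [_] := leqif_sum (P := xpredT) (fun i _ => leqif_eq (le_s i)).
  rewrite -(reindex_inj (h := s') (F := fun i => i : nat) (P := xpredT)) //;
    last exact: perm_inj.
  rewrite -(reindex_inj (h := s) (F := fun i => i : nat) (P := xpredT)) ?eqxx //;
    last exact: perm_inj.
  by move=> /esym/forallP/(_ i).
apply: eq_bigr => i _; congr dv.
by rewrite Ed eq_s (upper_unitriangularM hU' hY) // eqxx mulr1.
Qed.

Lemma bruhat_degree_lower n (L M : 'M[D]_n) w :
  lower_unitriangular L -> bruhat_degree M w -> bruhat_degree (L *m M) w.
Proof.
move=> hL [L' [d [s [U [hL' hU hd -> ->]]]]].
exists (L *m L'), d, s, U; split=> //; first exact: lower_unitriangularM.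
by rewrite !mulmxA.
Qed.

Lemma bruhat_degree_diag n (e : 'rV[D]_n) (M : 'M[D]_n) w :
  (forall i, e 0 i != 0) -> bruhat_degree M w ->
  bruhat_degree (diag_mx e *m M) (\sum_i dv (e 0 i) + w).
Proof.
move=> he [L [d [s [U [hL hU hd -> ->]]]]].
(* Moving [diag_mx e] past [L] conjugates [L], which keeps it lower unitriangular. *)
exists (\matrix_(i, j) (e 0 i * L i j / e 0 j)).
exists (\row_j (e 0 j * d 0 j)), s, U; split=> //.
- move=> i j le_ij; rewrite mxE hL //; have [->|] := eqVneq; last by rewrite mulr0 mul0r.
  by rewrite mulr1 skew_mulfV.
- by move=> i; rewrite mxE skew_mulf_neq0.
- rewrite !mulmxA; congr (_ *m _ *m _); apply/matrixP => i j.
  rewrite !mul_mx_diag mul_diag_mx !mxE.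
  by rewrite !mulrA -[_ / _ * _]mulrA skew_mulVf // mulr1.
- by rewrite -big_split; apply: eq_bigr => i _; rewrite mxE dvM.
Qed.

(** A transvection passes through a monomial matrix with its indices permuted by [s], so the order
    of [s a] and [s b] decides whether it comes out upper or lower unitriangular. *)
Lemma elem_diag_perm n a b c (d : 'rV[D]_n) s : d 0 a != 0 ->
  elem_mx a b c *m diag_mx d *m perm_mx s =
  diag_mx d *m perm_mx s *m elem_mx (s a) (s b) ((d 0 a)^-1 * c * d 0 b).
Proof.
move=> da; apply/matrixP => i j; rewrite -mulmxA mul_elem_mx mul_diag_perm_mx.
rewrite !diag_perm_mxE elem_mxE (inj_eq perm_inj) mulrDr mulr_natr; congr (_ + _).
have [->|_] /= := eqVneq i a; last by rewrite mulr0n mulr0.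
rewrite mulr1n [j == _]eq_sym; case: eqP => _; last by rewrite !mulr0.
by rewrite mulr1n !mulrA skew_mulfV // mul1r.
Qed.

(** Split off the entry [c] of [L] at [(b, a)]. What remains of [L] survives conjugation by the
    swap, and there is left the swap times one transvection times [D P U]. *)
Lemma bruhat_degree_swap n (a b : 'I_n) (M : 'M[D]_n) w : b = a.+1 :> nat ->
  bruhat_degree M w -> bruhat_degree (tperm_mx a b *m M) w.
Proof.
move=> ba [L [d [s [U [hL hU hd -> Ew]]]]].
have neq_ba : b != a by rewrite -val_eqE /= ba; lia.
have lt_ab : (a < b)%N by rewrite ba.
pose c := L b a; pose L1 := L *m elem_mx b a (- c).
have EL : L = L1 *m elem_mx b a c by rewrite -mulmxA elem_mxK // mulmx1.
have hL1 : lower_unitriangular L1.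
  exact/lower_unitriangularM/lower_elem_mx.
have L1ba : L1 b a = 0.
  rewrite mxE (bigD1 a) //= (bigD1 b) //= big1 ?addr0 => [|k /andP[ka kb]].
    rewrite !elem_mxE (hL b b) // !eqxx [a == b]eq_sym (negPf neq_ba) /= mulr0n addr0.
    by rewrite mulr1 mul1r add0r mulr1n subrr.
  by rewrite elem_mxE (negPf ka) (negPf kb) addr0 mulr0.
pose L2 := tperm_mx a b *m L1 *m tperm_mx a b.
have hL2 : lower_unitriangular L2 by exact: lower_tperm_conj.
have EL2 N : tperm_mx a b *m (L1 *m N) = L2 *m (tperm_mx a b *m N).
  by rewrite /L2 !mulmxA -[_ *m tperm_mx a b *m tperm_mx a b]mulmxA tperm_mxK mulmx1.
rewrite EL -!mulmxA [X in _ *m X](_ : _ =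
    L1 *m (elem_mx b a c *m diag_mx d *m perm_mx s *m U)); last by rewrite !mulmxA.
rewrite EL2; apply: bruhat_degree_lower => //.
(* If [c = 0] or [s b < s a], the transvection passes through [D P] into [U], and the swap is
   absorbed by the permutation. Otherwise the swap times the transvection is decomposed once more;
   this leaves a transvection with indices [a, b], which passes into [U] because [s a < s b]. *)
have [hc|/norP[c0 nlt_s]] := boolP ((c == 0) || (s b < s a)%N).
  rewrite elem_diag_perm //; set e := elem_mx _ _ _.
  have he : upper_unitriangular e.
    case/orP: hc => [/eqP c0|]; last exact: upper_elem_mx.
    rewrite /e c0 mulr0 mul0r elem_mx0 => i j _; by rewrite mxE.
  exists 1%:M, (\row_i d 0 (tperm a b i)), (tperm a b * s)%g, (e *m U); split.
  - exact: lower_unitriangular1.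
  - exact: upper_unitriangularM.
  - by move=> i; rewrite mxE.
  - rewrite mul1mx !mulmxA; congr (_ *m _ *m _); rewrite -mulmxA.
    apply/matrixP => i j; rewrite -row_permE mxE !diag_perm_mxE mxE permM.
    by [].
  - rewrite Ew (reindex_inj (@perm_inj _ (tperm a b))) /=.
    by apply: eq_bigr => i _; rewrite mxE.
have c_neq0 : c^-1 != 0 by apply: skew_invr_neq0.
have lt_s : (s a < s b)%N.
  rewrite ltn_neqAle leqNgt nlt_s andbT val_eqE (inj_eq perm_inj) eq_sym //.
pose e : 'rV[D]_n := \row_i (if i == a then c else if i == b then - c^-1 else 1).
(* The Bruhat decomposition [[c, 1], [1, 0]] of 2x2 matrices; the diagonal part
   [c, - c^-1] has total degree 0. *)
have Esw : tperm_mx a b *m elem_mx b a c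
           = elem_mx b a c^-1 *m diag_mx e *m elem_mx a b c^-1.
  have neq_ab : a != b by rewrite eq_sym.
  apply/matrixP => i j; rewrite -row_permE mxE -mulmxA mul_elem_mx !mul_diag_mx.
  pose simp := (eqxx, negPf neq_ab, negPf neq_ba, skew_mulVf D_field c0,
    skew_mulfV D_field c0, andbT, andbF, mulr1, mul1r, mulr0, mul0r, addr0,
    add0r, mulr0n, mulr1n, mulrA, mulrDr, mulNr, addNr).
  rewrite ![in RHS]mxE -!/(elem_mx _ _ _ _ _) !elem_mxE.
  rewrite eqxx [a == j]eq_sym; case: tpermP => [->|->|/eqP/negPf ia /eqP/negPf ib].
  - rewrite [b == j]eq_sym !simp /=.
    have [->|ja] := eqVneq j a; first by rewrite !simp.
    by rewrite !simp.
  - rewrite [b == j]eq_sym !simp /=.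
    have [->|ja] := eqVneq j a; first by rewrite !simp oppr0 add0r.
    by rewrite !simp.
  - by rewrite ia ib !simp.
rewrite !mulmxA Esw -!mulmxA; apply: bruhat_degree_lower; first exact: lower_elem_mx.
have -> : w = \sum_i dv (e 0 i) + w.
  rewrite (bigD1 a) //= (bigD1 b) //= big1 => [|i /andP[ia ib]].
    by rewrite !mxE !eqxx (negPf neq_ba) dvN dvV // addr0 subrr add0r.
  by rewrite mxE (negPf ia) (negPf ib) dv1.
apply: bruhat_degree_diag.
  move=> i; rewrite mxE; case: ifP => // _; case: ifP => _; last exact: oner_neq0.
  by rewrite oppr_eq0.
rewrite !mulmxA elem_diag_perm // -!mulmxA mulmxA.
exists 1%:M, d, s, (elem_mx (s a) (s b) ((d 0 a)^-1 * c^-1 * d 0 b) *m U); split=> //.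
- exact: lower_unitriangular1.
- exact/upper_unitriangularM/hU/upper_elem_mx.
- by rewrite mul1mx.
Qed.

End Bruhat.

Definition degree_add (a b : degree) : degree :=
  if a is Some x then if b is Some y then Some (x + y) else None else None.

Definition degree_max (a b : degree) : degree :=
  match a, b with
  | Some x, Some y => Some (Order.max x y)
  | None, _ => b
  | _, None => a
  end.

(** * Multiplicativity and existence of the degree, with singular matrices included *)

Section DetDegree.
Variables (D : unitRingType) (dv : D -> int).
Hypothesis D_field : GRing.field_axiom D.
Hypothesis dvM : forall x y, x != 0 -> y != 0 -> dv (x * y) = dv x + dv y.
Local Notation bruhat_degree := (bruhat_degree dv).

(** Induction on the distance of [a] and [b]: with [c = b - 1], the transposition of [a] and [b] is
    that of [a] and [c] conjugated by an adjacent one. *)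
Lemma bruhat_degree_tperm n (a b : 'I_n) (M : 'M[D]_n) w :
  bruhat_degree M w -> bruhat_degree (tperm_mx a b *m M) w.
Proof.
wlog lt_ab : a b / (a < b)%N => [hw|].
  have [lt_ab|lt_ba|/val_inj ->] := ltngtP a b; first exact: hw.
    by rewrite /tperm_mx tpermC; apply: hw.
  by rewrite /tperm_mx tperm1 perm_mx1 mul1mx.
move Ek: (b - a.+1)%N => k; elim: k => [|k IHk] in b lt_ab Ek M w *.
  by apply: (bruhat_degree_swap D_field dvM); lia.
move=> hM; have lt_b : (b.-1 < n)%N by have := ltn_ord b; lia.
pose c := Ordinal lt_b; have bc : b = c.+1 :> nat by rewrite /=; lia.
rewrite /tperm_mx (_ : tperm a b = (tperm c b * (tperm a c * tperm c b))%g); last first.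
  rewrite -{1}[tperm c b]tpermV -/(conjg _ _) tpermJ tpermL tpermD //;
    by rewrite -val_eqE /=; lia.
rewrite !perm_mxM -!mulmxA -!/(tperm_mx _ _).
apply: (bruhat_degree_swap D_field dvM) => //; apply: IHk; rewrite ?bc; [lia..|].
exact: (bruhat_degree_swap D_field dvM).
Qed.

Lemma bruhat_degree_perm n (s : 'S_n) (M : 'M[D]_n) w :
  bruhat_degree M w -> bruhat_degree (perm_mx s *m M) w.
Proof.
move=> hM; have [ts -> _] := prod_tpermP s.
elim: ts => [|t ts IHts]; first by rewrite big_nil perm_mx1 mul1mx.
by rewrite big_cons perm_mxM -mulmxA; apply: bruhat_degree_tperm.
Qed.

(** The factors [L], [D], [P] and [U] of [M] are applied to [M'] one at a time. The upper
    unitriangular one is a lower unitriangular matrix between two reversals, which are permutation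
    matrices. *)
Lemma bruhat_degreeM n (M M' : 'M[D]_n) w w' :
  bruhat_degree M w -> bruhat_degree M' w' -> bruhat_degree (M *m M') (w + w').
Proof.
move=> [L [d [s [U [hL hU hd -> ->]]]]] hM'; rewrite -!mulmxA.
apply: bruhat_degree_lower => //; apply: bruhat_degree_diag => //.
apply: bruhat_degree_perm; rewrite -[U]rev_conjK -!mulmxA.
apply: bruhat_degree_perm; rewrite !mulmxA -[_ *m M']mulmxA.
apply: bruhat_degree_lower; first exact: upper_rev_conj.
exact: bruhat_degree_perm.
Qed.

Lemma bruhat_degree_unit n (M : 'M[D]_n) w : bruhat_degree M w -> nonsingular M.
Proof.
move=> [L [d [s [U [hL hU hd -> _]]]]].
have [L' [_ LL' L'L]] := lower_unitriangularV hL.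
have [U' [_ UU' U'U]] := upper_unitriangularV hU.
pose d' : 'rV[D]_n := \row_i (d 0 i)^-1.
have dd' : diag_mx d *m diag_mx d' = 1%:M.
  by apply/matrixP => i j; rewrite mul_diag_mx !mxE mulrnAr skew_mulfV.
have d'd : diag_mx d' *m diag_mx d = 1%:M.
  by apply/matrixP => i j; rewrite mul_diag_mx !mxE mulrnAr skew_mulVf.
have ss' : perm_mx s *m perm_mx s^-1 = 1%:M :> 'M[D]_n by rewrite -perm_mxM mulgV perm_mx1.
have s's : perm_mx s^-1 *m perm_mx s = 1%:M :> 'M[D]_n by rewrite -perm_mxM mulVg perm_mx1.
have cancel4 (A1 A2 A3 A4 B1 B2 B3 B4 : 'M[D]_n) : A1 *m B1 = 1%:M ->
    A2 *m B2 = 1%:M -> A3 *m B3 = 1%:M -> A4 *m B4 = 1%:M ->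
    A1 *m A2 *m A3 *m A4 *m (B4 *m B3 *m B2 *m B1) = 1%:M.
  move=> e1 e2 e3 e4; rewrite -!mulmxA (mulmxA A4) e4 mul1mx (mulmxA A3) e3 mul1mx.
  by rewrite (mulmxA A2) e2 mul1mx.
by exists (U' *m perm_mx s^-1 *m diag_mx d' *m L'); split; apply: cancel4.
Qed.

Definition left_singular n (M : 'M[D]_n) : Prop :=
  exists2 z : 'rV[D]_n, z != 0 & z *m M = 0.

Lemma left_singular_nonsingular n (M : 'M[D]_n) :
  left_singular M -> ~ nonsingular M.
Proof.
move=> [z z0 zM] [M' [MM' _]]; case/negP: z0; apply/eqP.
by rewrite -[z]mulmx1 -MM' mulmxA zM mul0mx.
Qed.

(** Both outcomes carry a witness, a decomposition or a left kernel vector; such witnesses can be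
    transported through products, borders and embeddings. *)
Definition det_degree n (M : 'M[D]_n) (w : degree) : Prop :=
  if w is Some w then bruhat_degree M w else left_singular M.

Lemma det_degree_uniq n (M : 'M[D]_n) w w' :
  det_degree M w -> det_degree M w' -> w = w'.
Proof.
case: w w' => [w|] [w'|] //= h h'.
- by rewrite (bruhat_degree_uniq h h').
- by case: (left_singular_nonsingular h'); apply: bruhat_degree_unit h.
- by case: (left_singular_nonsingular h); apply: bruhat_degree_unit h'.
Qed.

Lemma det_degreeM n (M M' : 'M[D]_n) w w' :
  det_degree M w -> det_degree M' w' -> det_degree (M *m M') (degree_add w w').
Proof.
case: w => [w|] /=; last by move=> [z z0 zM] _; exists z; rewrite // mulmxA zM mul0mx.
case: w' => [w'|] /= hM; first exact: bruhat_degreeM.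
have [N [MN NM]] := bruhat_degree_unit hM.
(* A kernel vector of [M'] is pulled back through the inverse of [M]. *)
move=> [z z0 zM']; exists (z *m N); last by rewrite mulmxA -[z *m N *m M]mulmxA NM mulmx1.
by apply: contraNneq z0 => zN; rewrite -[z]mulmx1 -NM mulmxA zN mul0mx.
Qed.

Lemma det_degree_lower n (L : 'M[D]_n) : lower_unitriangular L -> det_degree L (Some 0).
Proof.
move=> hL; exists L, (const_mx 1), 1%g, 1%:M; split=> //.
- by move=> i j _; rewrite mxE.
- by move=> i; rewrite mxE oner_neq0.
- by rewrite perm_mx1 !mulmx1 diag_const_mx mulmx1.
- by rewrite big1 // => i _; rewrite mxE (dv1 dvM).
Qed.

Lemma det_degree_upper n (U : 'M[D]_n) : upper_unitriangular U -> det_degree U (Some 0).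
Proof.
move=> hU; exists 1%:M, (const_mx 1), 1%g, U; split=> //.
- exact: lower_unitriangular1.
- by move=> i; rewrite mxE oner_neq0.
- by rewrite perm_mx1 diag_const_mx !mul1mx.
- by rewrite big1 // => i _; rewrite mxE (dv1 dvM).
Qed.

Lemma degree_add0l a : degree_add (Some 0) a = a.
Proof. by case: a => //= a; rewrite add0r. Qed.

Lemma degree_add0r a : degree_add a (Some 0) = a.
Proof. by case: a => //= a; rewrite addr0. Qed.

Definition skew_degree (x : D) : degree := if x == 0 then None else Some (dv x).

Lemma det_degree_block n (a : D) (M : 'M[D]_n) w : det_degree M w ->
  det_degree (block_mx (a%:M : 'M_1) 0 0 M : 'M_(1 + n)) (degree_add (skew_degree a) w).
Proof.
rewrite /skew_degree; have [->|a0] := eqVneq.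
  move=> _; exists (row_mx (1%:M : 'M_1) (0 : 'rV_n)).
    apply/eqP => /matrixP/(_ 0 (lshift n 0)); rewrite row_mxEl !mxE.
    by apply/eqP; rewrite oner_neq0.
  by rewrite mul_row_block !mul0mx mulmx0 !mul1mx raddf0 !addr0 row_mx0.
case: w => [w|] /=; last first.
  move=> [z z0 zM]; exists (row_mx (0 : 'M_1) z).
    apply: contraNneq z0 => z0; apply/eqP; rewrite -[z](row_mxKr (0 : 'M_1)) z0.
    by apply/matrixP => i j; rewrite !mxE.
  by rewrite mul_row_block !mulmx0 !mul0mx zM !addr0 row_mx0.
move=> [L [d [s [U [hL hU hd -> ->]]]]].
exists (block_mx (1%:M : 'M_1) 0 0 L), (row_mx (a%:M : 'M_1) d), (lift0_perm s).
exists (block_mx (1%:M : 'M_1) 0 0 U); split.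
- exact: lower_block.
- exact: upper_block.
- move=> i; rewrite -[i](@splitK 1 n); case: split => j /=.
    by rewrite row_mxEl mxE !ord1.
  by rewrite row_mxEr.
- rewrite -lift0_mx_perm /lift0_mx.
  have -> : diag_mx (row_mx (a%:M : 'M_1) d) = block_mx (a%:M : 'M_1) 0 0 (diag_mx d).
    by rewrite diag_mx_row; congr block_mx; apply/matrixP => i j; rewrite !ord1 !mxE.
  by rewrite !(@mulmx_block _ 1 n 1 n 1 n) !(mul0mx, mulmx0, addr0, add0r, mul1mx, mulmx1).
- rewrite (@big_split_ord _ _ _ 1 n) big_ord1 row_mxEl mxE eqxx; congr (_ + _).
  by apply: eq_bigr => i _; rewrite row_mxEr.
Qed.

(** * Bordered matrices and their Schur complements *)

Section Schur.
Variables (n : nat) (y : D) (u : 'cV[D]_n) (v : 'rV[D]_n) (B : 'M[D]_n).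

Definition border_mx : 'M[D]_(1 + n) := block_mx (y%:M : 'M_1) v u B.

(** Block elimination with the corner [y] as pivot. *)
Lemma det_degree_border_corner w : y != 0 ->
  det_degree (B - u *m (y^-1)%:M *m v) w ->
  det_degree border_mx (degree_add (skew_degree y) w).
Proof.
move=> y0 hA; pose A := B - u *m (y^-1)%:M *m v.
have -> : border_mx = block_mx (1%:M : 'M_1) 0 (u *m (y^-1)%:M) 1%:M
    *m (block_mx (y%:M : 'M_1) 0 0 A *m block_mx (1%:M : 'M_1) ((y^-1)%:M *m v) 0 1%:M).
  rewrite !mulmx_block !(mul0mx, mulmx0, addr0, add0r, mul1mx, mulmx1).
  have yV : y%:M *m (y^-1)%:M = 1%:M :> 'M_1 by rewrite -scalar_mxM skew_mulfV.
  have Vy : (y^-1)%:M *m y%:M = 1%:M :> 'M_1 by rewrite -scalar_mxM skew_mulVf.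
  rewrite (mulmxA y%:M) yV mul1mx -(mulmxA u _ y%:M) Vy mulmx1.
  by rewrite /A addrC subrK.
rewrite -[degree_add _ _]degree_add0l; apply: det_degreeM.
  exact/det_degree_lower/lower_block/lower_unitriangular1.
rewrite -[degree_add _ _]degree_add0r; apply: det_degreeM.
  exact: det_degree_block.
apply/det_degree_upper/upper_block => i j _; by rewrite mxE.
Qed.

(** Block elimination with [B] as pivot; the Schur complement is then a scalar. *)
Lemma det_degree_border_block B' w : B *m B' = 1%:M -> B' *m B = 1%:M ->
  det_degree B w ->
  det_degree border_mx (degree_add (skew_degree (y - (v *m B' *m u) 0 0)) w).
Proof.
move=> BB' B'B hB; set c := _ - _.
have -> : border_mx = block_mx (1%:M : 'M_1) (v *m B') 0 1%:M
    *m (block_mx (c%:M : 'M_1) 0 0 B *m block_mx (1%:M : 'M_1) 0 (B' *m u) 1%:M).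
  rewrite !mulmx_block !(mul0mx, mulmx0, addr0, add0r, mul1mx, mulmx1).
  rewrite (mulmxA B) BB' mul1mx -(mulmxA v B' B) B'B mulmx1; congr block_mx.
  by apply/matrixP => i j; rewrite !ord1 /c !mxE !mulr1n subrK.
rewrite -[degree_add _ _]degree_add0l; apply: det_degreeM.
  apply/det_degree_upper/upper_block => i j _; by rewrite mxE.
rewrite -[degree_add _ _]degree_add0r; apply: det_degreeM.
  exact: det_degree_block.
exact/det_degree_lower/lower_block/lower_unitriangular1.
Qed.

End Schur.

(** The hypothesis says that [y] does not cancel against [v B^-1 u] and counts with degree 0. For
    invertible [B], the borders with corners [y] and 0 are compared through their scalar Schur
    complements. For singular [B], the corner turns out not to affect the degree. *)
Lemma det_degree_border n y (u : 'cV[D]_n) (v : 'rV[D]_n) (B : 'M[D]_n) wB w0 :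
  (forall B', B *m B' = 1%:M -> B' *m B = 1%:M ->
     skew_degree (y - (v *m B' *m u) 0 0)
     = degree_max (Some 0) (skew_degree (- (v *m B' *m u) 0 0))) ->
  det_degree B wB -> det_degree (border_mx 0 u v B) w0 ->
  det_degree (border_mx y u v B) (degree_max wB w0).
Proof.
move=> hy; case: wB => [wB|] hB h0.
  have [B' [BB' B'B]] := bruhat_degree_unit hB.
  have hBy c : det_degree (border_mx c u v B)
      (degree_add (skew_degree (c - (v *m B' *m u) 0 0)) (Some wB)).
    exact: det_degree_border_block.
  have := hBy y; rewrite hy //.
  have := hBy 0; rewrite sub0r => /det_degree_uniq/(_ h0) <-.
  case: (skew_degree _) => [e|] /=; last by rewrite add0r.
  congr (det_degree _ (Some _)).
  by lia.
have [z z0 zB] := hB.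
(* If the kernel vector [z] of [B] also kills [u], then [(0, z)] kills the border whatever its
   corner. *)
have [zu0|zu0] := eqVneq ((z *m u) 0 0) 0.
  have Hs c : det_degree (border_mx c u v B) None.
    exists (row_mx (0 : 'M_1) z).
      apply: contraNneq z0 => z0; apply/eqP; rewrite -[z](row_mxKr (0 : 'M_1)) z0.
      by apply/matrixP => a b; rewrite !mxE.
    rewrite mul_row_block !mul0mx zB !add0r.
    have -> : z *m u = 0 by apply/matrixP => a b; rewrite !ord1 zu0 mxE.
    by rewrite row_mx0.
  by rewrite (det_degree_uniq h0 (Hs 0)); apply: Hs.
(* Since [z B = 0] and [z u] is invertible, adding this multiple of the combination [z] of the lower
   rows to the first row changes only the corner, from 0 to [y]. *)
pose t := (y / (z *m u) 0 0)%:M *m z : 'rV_n.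
have -> : border_mx y u v B
    = block_mx (1%:M : 'M_1) t 0 1%:M *m border_mx 0 u v B.
  rewrite mulmx_block !(mul1mx, mul0mx, add0r) /t -!mulmxA zB mulmx0 addr0.
  congr block_mx; rewrite raddf0 add0r.
  by apply/matrixP => a b; rewrite !ord1 mul_scalar_mx [LHS]mxE [RHS]mxE divrK ?D_field.
rewrite -[degree_max _ _]degree_add0l; apply: det_degreeM => //.
by apply/det_degree_upper/upper_block => a b _; rewrite mxE.
Qed.

Lemma det_degree_perm n (s : 'S_n) : det_degree (perm_mx s) (Some 0).
Proof.
rewrite -[perm_mx s]mulmx1; apply: bruhat_degree_perm.
exact: (det_degree_lower (@lower_unitriangular1 _ n)).
Qed.

(** Gaussian elimination: a nonzero entry is brought to the corner by two swaps, and induction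
    applies to the Schur complement. *)
Lemma det_degree_exists n (M : 'M[D]_n) : exists w, det_degree M w.
Proof.
elim: n M => [|n IHn] M.
  exists (Some 0); rewrite [M](_ : _ = 1%:M); last by apply/matrixP => -[].
  exact/det_degree_lower/lower_unitriangular1.
have [->|/eqP M0] := eqVneq M 0.
  exists None; exists (delta_mx 0 0); last by rewrite mulmx0.
  apply/eqP => /matrixP/(_ 0 0)/eqP; rewrite !mxE !eqxx.
  by rewrite oner_eq0.
have [i [j Mij]] : exists i j, M i j != 0.
  case: (pickP (fun ij => M ij.1 ij.2 != 0)) => [[i j] /= h|h]; first by exists i, j.
  by case: M0; apply/matrixP => i j; rewrite mxE; apply/eqP/negbFE/(h (i, j)).
have [N [EM N00]] : exists N : 'M[D]_(1 + n),
    M = tperm_mx 0 i *m (N *m tperm_mx 0 j) /\ N 0 0 = M i j.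
  exists (tperm_mx 0 i *m M *m tperm_mx 0 j); split.
    by rewrite !mulmxA tperm_mxK mul1mx -mulmxA tperm_mxK mulmx1.
  by rewrite /tperm_mx -row_permE -[tperm 0 j]tpermV -col_permE !mxE !tpermL.
have EN : N = border_mx (N 0 0) (dlsubmx N) (ursubmx N) (drsubmx N).
  rewrite -[LHS]submxK /border_mx; congr block_mx.
  apply/matrixP => k l; rewrite !ord1 !mxE; congr (N _ _); exact: val_inj.
have y0 : N 0 0 != 0 by rewrite N00.
have [w hw] := IHn (drsubmx N - dlsubmx N *m (N 0 0)^-1%:M *m ursubmx N).
move: (det_degree_border_corner y0 hw); rewrite -EN => {}hw.
exists (degree_add (Some 0) (degree_add (degree_add (skew_degree (N 0 0)) w) (Some 0))).
rewrite EM; apply: det_degreeM; first exact: det_degree_perm.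
apply: det_degreeM => //; exact: det_degree_perm.
Qed.

End DetDegree.

Lemma skew_rmorph_inj (E : unitRingType) (R : nzRingType) (g : {rmorphism E -> R}) :
  GRing.field_axiom E -> injective g.
Proof.
move=> E_field; apply: raddf_inj => x gx; apply/eqP; apply: contraTT (oner_neq0 R).
move=> x0; rewrite -(rmorph1 g) -(skew_mulVf E_field x0) rmorphM gx mulr0.
by rewrite eqxx.
Qed.

(** * Right fractions and the extension of morphisms to them *)

Section Fractions.
Variables (R : nzRingType) (D : unitRingType) (i : {rmorphism R -> D}).
Hypotheses (D_field : GRing.field_axiom D) (i_inj : injective i).
Hypothesis i_surj : forall d, exists p q : R, q != 0 /\ d = i p / i q.

Lemma frac_emb_neq0 (p : R) : p != 0 -> i p != 0.
Proof. by rewrite raddf_eq0. Qed.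

(** The Ore condition: the left fraction [q^-1 p] is an element of [D], hence also a right fraction
    [a b^-1]. *)
Lemma ore_mul (p q : R) : q != 0 -> exists a b, b != 0 /\ p * b = q * a.
Proof.
move=> q0; have [a [b [b0 E]]] := i_surj ((i q)^-1 * i p).
have iq := frac_emb_neq0 q0; have ib := frac_emb_neq0 b0.
exists a, b; split=> //; apply: i_inj; rewrite !rmorphM.
have -> : i a = (i q)^-1 * i p * i b by rewrite E divrK ?D_field.
by rewrite !mulrA skew_mulfV // mul1r.
Qed.

Lemma frac_emb_mul_neq0 (p q : R) : p != 0 -> q != 0 -> p * q != 0.
Proof.
move=> /frac_emb_neq0 p0 /frac_emb_neq0 q0.
by apply: contraNneq (skew_mulf_neq0 D_field p0 q0); rewrite -rmorphM => ->; rewrite raddf0.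
Qed.

Lemma common_denominator (q q' : R) : q != 0 -> q' != 0 ->
  exists a b, [/\ a != 0, b != 0 & q * a = q' * b].
Proof.
move=> q0 q'0; have [b [a [a0 E]]] := ore_mul q q'0.
exists a, b; split=> //; apply: contraNneq (frac_emb_mul_neq0 q0 a0) => b0.
by rewrite E b0 mulr0.
Qed.

Section Extension.
Variables (E : unitRingType) (g : {rmorphism R -> E}).
Hypotheses (E_field : GRing.field_axiom E) (g_inj : injective g).

Lemma frac_expand (p q a : R) : q != 0 -> a != 0 -> g (p * a) / g (q * a) = g p / g q.
Proof.
rewrite -(raddf_eq0 q g_inj) -(raddf_eq0 a g_inj) => q0 a0.
by rewrite !rmorphM invrM ?E_field // mulrA mulrK ?E_field.
Qed.

End Extension.

(** The value is defined through a chosen representative. Any two representatives have a common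
    denominator, over which their numerators agree, so the choice does not matter. *)
Lemma frac_extend (E : unitRingType) (g : {rmorphism R -> E}) :
  GRing.field_axiom E -> injective g ->
  exists G : {rmorphism D -> E},
    forall p q : R, q != 0 -> G (i p / i q) = g p / g q.
Proof.
move=> E_field g_inj.
have nd d : {pq : R * R | pq.2 != 0 /\ d = i pq.1 / i pq.2}.
  by apply: constructive_indefinite_description; have [p [q]] := i_surj d; exists (p, q).
pose G d := g (sval (nd d)).1 / g (sval (nd d)).2.
have GE p q : q != 0 -> G (i p / i q) = g p / g q.
  move=> q0; rewrite /G; case: (nd _) => -[p' q'] /= [q'0 Ed].
  have [a [b [a0 b0 Eab]]] := common_denominator q0 q'0.
  have qa0 := frac_emb_mul_neq0 q0 a0.
  rewrite -(frac_expand E_field g_inj p' q'0 b0).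
  rewrite -(frac_expand E_field g_inj p q0 a0) -Eab.
  congr (g _ / _); apply: i_inj.
  move: Ed; rewrite -(frac_expand D_field i_inj p' q'0 b0).
  rewrite -(frac_expand D_field i_inj p q0 a0) -Eab.
  by move/(congr1 (fun x => x * i (q * a))); rewrite !divrK ?D_field ?frac_emb_neq0.
have Gsub : zmod_morphism G.
  move=> d d'; have [p [q [q0 ->]]] := i_surj d; have [p' [q' [q'0 ->]]] := i_surj d'.
  have [a [b [a0 b0 Eab]]] := common_denominator q0 q'0.
  rewrite -(frac_expand D_field i_inj p q0 a0) -(frac_expand D_field i_inj p' q'0 b0).
  have qa0 := frac_emb_mul_neq0 q0 a0.
  by rewrite -Eab -mulrBl -rmorphB !GE // -mulrBl rmorphB.
have Gmon : monoid_morphism G.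
  split=> [|d d'].
    by rewrite -[1 in LHS](divr1 1) -(rmorph1 i) GE ?oner_neq0 // !rmorph1 divr1.
  have [p [q [q0 ->]]] := i_surj d; have [p' [q' [q'0 ->]]] := i_surj d'.
  have [a [b [b0 Eab]]] := ore_mul p' q0.
  (* As [q^-1 p' = a b^-1], the product of the two fractions is given by one formula, valid in [D]
     and in [E] alike. *)
  have frac_mul (E' : unitRingType) (h : {rmorphism R -> E'}) :
      GRing.field_axiom E' -> injective h ->
      h p / h q * (h p' / h q') = h (p * a) / h (q' * b).
    move=> E'_field h_inj; rewrite -[h p' / h q'](frac_expand E'_field h_inj _ q'0 b0) Eab.
    by rewrite !rmorphM !mulrA mulrVK // E'_field // raddf_eq0.
  by rewrite !frac_mul // !GE ?frac_mul // frac_emb_mul_neq0.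
pose Ga := GRing.isZmodMorphism.Build _ _ G Gsub.
pose Gm := GRing.isMonoidMorphism.Build _ _ G Gmon.
pose GR : {rmorphism D -> E} := HB.pack G Ga Gm.
by exists GR.
Qed.

End Fractions.

(** * The degree in [t] on [F(t)] *)

Section PolyDegree.
Variables (F : unitRingType) (F_field : GRing.field_axiom F).

Lemma skew_size_mul (p q : {poly F}) : p != 0 -> q != 0 ->
  size (p * q) = (size p + size q).-1.
Proof.
by move=> p0 q0; rewrite size_proper_mul // skew_mulf_neq0 ?lead_coef_eq0.
Qed.

Lemma skew_size_map (R : nzRingType) (g : {rmorphism F -> R}) (p : {poly F}) :
  size (map_poly g p) = size p.
Proof.
apply: size_map_inj_poly (raddf0 g) p; exact: skew_rmorph_inj F_field.
Qed.

Variables (D : unitRingType) (j : {rmorphism {poly F} -> D}).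
Hypothesis Dj : skew_fractions j.

(** Meaningless at [d = 0]. *)
Definition ratdeg_int (d : D) : int :=
  (size (numden j d).1)%:Z - (size (numden j d).2)%:Z.

Let D_field := sf_skew_field Dj.
Let j_inj := sf_inj Dj.

Lemma numdenP d : (numden j d).2 != 0 /\ d = j (numden j d).1 / j (numden j d).2.
Proof.
apply: (epsilon_spec (inhabits (0, 1)) (fun pq => pq.2 != 0 /\ d = j pq.1 / j pq.2)).
by have [p [q [q0 Ed]]] := sf_surj Dj d; exists (p, q).
Qed.

Lemma frac_eq0 (p q : {poly F}) : q != 0 -> (j p / j q == 0) = (p == 0).
Proof.
move=> q0; have jq := frac_emb_neq0 j_inj q0.
have [->|p0] := eqVneq p 0; first by rewrite raddf0 mul0r eqxx.
apply/negbTE/skew_mulf_neq0 => //; first exact: frac_emb_neq0.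
exact: skew_invr_neq0.
Qed.

Lemma ratdegE d : ratdeg j d = skew_degree ratdeg_int d.
Proof.
rewrite /ratdeg /skew_degree /ratdeg_int; case: (numdenP d).
case: (numden j d) => p q /= q0 Ed.
by rewrite [in RHS]Ed frac_eq0.
Qed.

(** Over a common denominator two representatives have equal numerators, and sizes of products are
    additive up to a shift by one, which cancels in the difference. *)
Lemma ratdeg_frac (p q : {poly F}) : p != 0 -> q != 0 ->
  ratdeg_int (j p / j q) = (size p)%:Z - (size q)%:Z.
Proof.
move=> p0 q0; rewrite /ratdeg_int; set d := _ / _.
case: (numdenP d); case: (numden j d) => p' q' /= q'0 Ed.
have p'0 : p' != 0 by rewrite -(frac_eq0 p' q'0) -Ed frac_eq0.
have [a [b [a0 b0 Eab]]] := common_denominator D_field j_inj (sf_surj Dj) q0 q'0.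
have qa0 := frac_emb_mul_neq0 D_field j_inj q0 a0.
have Epa : p * a = p' * b.
  apply: j_inj; move: Ed; rewrite /d -(frac_expand D_field j_inj p' q'0 b0).
  rewrite -(frac_expand D_field j_inj p q0 a0) -Eab.
  by move/(congr1 (fun x => x * j (q * a))); rewrite !divrK ?D_field ?frac_emb_neq0.
have := congr1 (fun p : {poly F} => size p) Epa.
have := congr1 (fun p : {poly F} => size p) Eab.
rewrite !skew_size_mul //.
move: p0 q0 p'0 q'0 a0 b0; rewrite -!size_poly_gt0 /=.
move: (size p) (size q) (size a) (size p') (size q') (size b) => *; lia.
Qed.

Lemma ratdeg_intM x y : x != 0 -> y != 0 ->
  ratdeg_int (x * y) = ratdeg_int x + ratdeg_int y.
Proof.
have [p [q [q0 ->]]] := sf_surj Dj x; have [p' [q' [q'0 ->]]] := sf_surj Dj y.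
rewrite !frac_eq0 // => p0 p'0.
have [a [b [b0 Eab]]] := ore_mul D_field j_inj (sf_surj Dj) p' q0.
have a0 : a != 0.
  apply: contraNneq (frac_emb_mul_neq0 D_field j_inj p'0 b0) => a0.
  by rewrite Eab a0 mulr0.
have -> : j p / j q * (j p' / j q') = j (p * a) / j (q' * b).
  rewrite -[j p' / j q'](frac_expand D_field j_inj _ q'0 b0) Eab.
  by rewrite !rmorphM !mulrA mulrVK // D_field // raddf_eq0.
have mul_neq0 := frac_emb_mul_neq0 D_field j_inj.
rewrite !ratdeg_frac ?mul_neq0 // !skew_size_mul //.
(* The Ore relation used to multiply the fractions also relates the sizes of its four factors. *)
have := congr1 (fun p : {poly F} => size p) Eab; rewrite !skew_size_mul //.
move: p0 q0 p'0 q'0 a0 b0; rewrite -!size_poly_gt0.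
move: (size p) (size q) (size a) (size p') (size q') (size b) => *; lia.
Qed.

Lemma ratdeg_const c : c != 0 -> ratdeg_int (j c%:P) = 0.
Proof.
move=> c0; rewrite -[j _]divr1 -(rmorph1 j) ratdeg_frac ?oner_neq0 ?polyC_eq0 //.
by rewrite size_polyC c0 size_poly1.
Qed.

(** [phi] is injective, so applying it to the coefficients preserves the sizes of numerator and
    denominator. *)
Lemma ratdeg_ext (G : {rmorphism D -> D}) (phi : {rmorphism F -> F}) :
  (forall p q : {poly F}, q != 0 ->
     G (j p / j q) = j (map_poly phi p) / j (map_poly phi q)) ->
  forall d, d != 0 -> ratdeg_int (G d) = ratdeg_int d.
Proof.
move=> GE d; have [p [q [q0 ->]]] := sf_surj Dj d; rewrite frac_eq0 // => p0.
have map_neq0 r : r != 0 -> map_poly phi r != 0.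
  by rewrite -!size_poly_gt0 skew_size_map.
by rewrite GE // !ratdeg_frac ?map_neq0 // !skew_size_map.
Qed.

Lemma ratdeg_ext_const (G : {rmorphism D -> D}) (phi : {rmorphism F -> F}) c :
  (forall p q : {poly F}, q != 0 ->
     G (j p / j q) = j (map_poly phi p) / j (map_poly phi q)) ->
  G (j c%:P) = j (phi c)%:P.
Proof.
move=> GE; rewrite -[j c%:P]divr1 -(rmorph1 j) GE ?oner_neq0 //.
by rewrite map_polyC rmorph1 !rmorph1 divr1.
Qed.

(** If [y + h] dropped in degree, so would its image [phi y + h], and then
    also the nonzero constant [y - phi y]. *)
Lemma ratdeg_shift (G : {rmorphism D -> D}) (phi : {rmorphism F -> F}) c h :
  (forall p q : {poly F}, q != 0 ->
     G (j p / j q) = j (map_poly phi p) / j (map_poly phi q)) ->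
  phi c != c -> G h = h ->
  skew_degree ratdeg_int (j c%:P + h)
  = degree_max (Some 0) (skew_degree ratdeg_int h).
Proof.
move=> GE phic Gh.
have GC e := ratdeg_ext_const e GE.
have c0 : c != 0 by apply: contraNneq phic => ->; rewrite raddf0.
have size_c (e : F) (r : {poly F}) : e != 0 -> size (e *: r) = size r.
  move=> e0; have [->|r0] := eqVneq r 0; first by rewrite scaler0.
  by rewrite -mul_polyC skew_size_mul ?polyC_eq0 // size_polyC e0.
rewrite /skew_degree; have [->|h0] := eqVneq h 0.
  rewrite addr0 ratdeg_const // -(raddf0 j) (inj_eq j_inj) polyC_eq0 (negPf c0).
  by [].
have [p [q [q0 Eh]]] := sf_surj Dj h.
have p0 : p != 0 by rewrite -(frac_eq0 p q0) -Eh.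
have yhE e : j e%:P + h = j (e *: q + p) / j q.
  by rewrite raddfD /= mulrDl -Eh -mul_polyC rmorphM mulrK // D_field // frac_emb_neq0.
have yh0 : j c%:P + h != 0.
  apply: contraNneq phic => yh0; apply/eqP.
  have : G (j c%:P + h) = j c%:P + h by rewrite yh0 raddf0.
  by rewrite raddfD /= Gh GC => /addIr/j_inj/polyC_inj.
have s0 : c *: q + p != 0 by rewrite -(frac_eq0 _ q0) -yhE.
have Gyh : G (j c%:P + h) = j (phi c *: q + p) / j q.
  by rewrite raddfD /= Gh GC yhE.
have s'0 : phi c *: q + p != 0.
  by rewrite -(frac_eq0 _ q0) -Gyh raddf_eq0 //; exact: skew_rmorph_inj D_field.
have size_s' : size (phi c *: q + p) = size (c *: q + p).
  have := ratdeg_ext GE yh0; rewrite Gyh yhE !ratdeg_frac //.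
  by move/addIr => [].
rewrite (negPf yh0) yhE Eh !ratdeg_frac //=; congr Some.
have [lt_pq|lt_qp|eq_pq] := ltngtP (size p) (size q).
- rewrite size_polyDl ?size_c //.
  by move: (size p) (size q) lt_pq => *; lia.
- rewrite [_ *: q + p]addrC size_polyDl ?size_c //.
  by move: (size p) (size q) lt_qp => *; lia.
have le_s : (size (c *: q + p)%R <= size q)%N.
  by rewrite (leq_trans (size_polyD _ _)) // size_c // eq_pq maxnn.
suff : (size q <= size (c *: q + p)%R)%N.
  by move: (size p) (size q) (size (c *: q + p)%R) eq_pq le_s => *; lia.
have cphi : c - phi c != 0 by rewrite subr_eq0 eq_sym.
rewrite -(size_c _ q cphi).
have -> : (c - phi c) *: q = (c *: q + p) - (phi c *: q + p).
  by rewrite scalerBl opprD addrACA subrr addr0.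
by rewrite (leq_trans (size_polyD _ _)) // size_polyN size_s' maxnn.
Qed.

End PolyDegree.

Lemma field_skew (k : fieldType) : GRing.field_axiom k.
Proof. by move=> x x0; rewrite unitfE. Qed.

(** * Comparison with the ordinary determinant over a commutative field *)

Section CommutativeDegree.
Variables (k : fieldType) (dk : k -> int).
Hypothesis dkM : forall x y, x != 0 -> y != 0 -> dk (x * y) = dk x + dk y.

Lemma det_lower_unitriangular n (L : 'M[k]_n) :
  lower_unitriangular L -> \det L = 1.
Proof.
move=> hL; rewrite det_trig; first by rewrite big1 // => i _; rewrite hL // eqxx.
by apply/is_trig_mxP => i j lt_ij; rewrite hL 1?ltnW // -val_eqE ltn_eqF.
Qed.

Lemma det_upper_unitriangular n (U : 'M[k]_n) :
  upper_unitriangular U -> \det U = 1.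
Proof.
move=> hU; rewrite -det_tr; apply: det_lower_unitriangular => i j le_ij.
by rewrite mxE hU // eq_sym.
Qed.

Lemma det_degree_det n (A : 'M[k]_n) w :
  det_degree dk A w -> skew_degree dk (\det A) = w.
Proof.
case: w => [w|] /=; last by move=> /det0P/eqP ->; rewrite /skew_degree eqxx.
move=> [L [d [s [U [hL hU hd -> ->]]]]].
rewrite !det_mulmx (det_lower_unitriangular hL) (det_upper_unitriangular hU).
rewrite mul1r mulr1 det_diag det_perm /skew_degree.
have dprod_neq0 (r : seq 'I_n) : \prod_(i <- r) d 0 i != 0.
  by rewrite prodf_seq_neq0; apply/allP => i _; rewrite hd.
have dprod (r : seq 'I_n) : dk (\prod_(i <- r) d 0 i) = \sum_(i <- r) dk (d 0 i).
  elim: r => [|i r IHr]; first by rewrite !big_nil (dv1 dkM).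
  by rewrite !big_cons dkM ?hd ?dprod_neq0 // IHr.
have sgn0 : (-1) ^+ odd_perm s != 0 :> k by rewrite signr_eq0.
rewrite mulf_eq0 (negPf (dprod_neq0 _)) (negPf sgn0) dkM // dprod.
by case: (odd_perm s); rewrite ?expr1 ?(dvN1 dkM) ?(dv1 dkM) addr0.
Qed.

End CommutativeDegree.

(** * The recursion over the variables for rank-one coefficients *)

Section LinearDegree.
Variables (k : fieldType) (dk : k -> int).
Hypothesis dkM : forall x y, x != 0 -> y != 0 -> dk (x * y) = dk x + dk y.

(** Unrolled, this is the maximum, over the subsets [S] of the variables, of the degree of the
    determinant of [[[0, V], [U, A0]]], where [U] and [V] collect the [u i] and [v i] for [i] in
    [S]. It refers to [k] only, so it can serve as the common value for different fields of
    coefficients. *)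
Fixpoint linear_degree (I : eqType) (r : seq I) n (A0 : 'M[k]_n)
    (u : I -> 'cV[k]_n) (v : I -> 'rV[k]_n) : degree :=
  if r is i :: r' then
    degree_max (linear_degree r' A0 u v)
      (linear_degree r' (border_mx 0 (u i) (v i) A0)
         (fun l => col_mx (0 : 'M_1) (u l)) (fun l => row_mx (0 : 'M_1) (v l)))
  else skew_degree dk (\det A0).

Variables (F : unitRingType) (F_field : GRing.field_axiom F).
Variables (D : unitRingType) (j : {rmorphism {poly F} -> D}).
Hypothesis Dj : skew_fractions j.
Let D_field := sf_skew_field Dj.
Let dv := ratdeg_int j.
Let dvM := ratdeg_intM F_field Dj.

Variable emb : {rmorphism k -> D}.
Hypothesis emb_deg : forall a, a != 0 -> dv (emb a) = dk a.

(** The embedding carries decompositions to decompositions and kernel vectors to kernel vectors. *)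
Lemma det_degree_map n (A : 'M[k]_n) w :
  det_degree dk A w -> det_degree dv (map_mx emb A) w.
Proof.
have emb_inj : injective emb by apply: skew_rmorph_inj (@field_skew k).
case: w => [w|] /=; last first.
  move=> [z z0 zA]; exists (map_mx emb z); last by rewrite -map_mxM zA map_mx0.
  apply: contraNneq z0 => /matrixP z0; apply/eqP/matrixP => a b.
  by apply: emb_inj; have := z0 a b; rewrite !mxE raddf0.
move=> [L [d [s [U [hL hU hd -> ->]]]]].
exists (map_mx emb L), (map_mx emb d), s, (map_mx emb U); split.
- by move=> a b le_ab; rewrite mxE hL // rmorph_nat.
- by move=> a b le_ab; rewrite mxE hU // rmorph_nat.
- by move=> i; rewrite mxE raddf_eq0.
- by rewrite !map_mxM map_perm_mx map_diag_mx.
- by apply: eq_bigr => i _; rewrite mxE emb_deg.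
Qed.

Variables (I : eqType) (x : I -> F).
Hypothesis x_comm : forall i a, j (x i)%:P * emb a = emb a * j (x i)%:P.
Hypothesis x_generic :
  forall i, exists (phi : {rmorphism F -> F}) (G : {rmorphism D -> D}),
  [/\ forall p q : {poly F}, q != 0 ->
        G (j p / j q) = j (map_poly phi p) / j (map_poly phi q),
      forall a, G (emb a) = emb a,
      forall l, l != i -> phi (x l) = x l
    & phi (x i) != x i].

Definition rank1_pencil (r : seq I) n (A0 : 'M[k]_n) (u : I -> 'cV[k]_n)
    (v : I -> 'rV[k]_n) : 'M[D]_n :=
  map_mx emb A0 + \sum_(i <- r) j (x i)%:P *: map_mx emb (u i *m v i).

Lemma rank1_pencil_border r n A0 (u : I -> 'cV[k]_n) v (a : 'cV[k]_n) b :
  rank1_pencil r (border_mx 0 a b A0) (fun l => col_mx (0 : 'M_1) (u l))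
    (fun l => row_mx (0 : 'M_1) (v l))
  = border_mx 0 (map_mx emb a) (map_mx emb b) (rank1_pencil r A0 u v).
Proof.
rewrite /rank1_pencil /border_mx; elim: r => [|i r IHr].
  by rewrite !big_nil !addr0 map_block_mx !raddf0.
rewrite !big_cons !(addrCA (map_mx emb _)) IHr.
rewrite mul_col_row !(mul0mx, mulmx0) map_block_mx.
by rewrite scale_block_mx add_block_mx !raddf0 !add0r.
Qed.

(** Induction on the list of variables: the border of [B] with corner [y = - 1/x_i] has the same
    degree as the pencil, and [det_degree_border] splits it into the two branches of
    [linear_degree]. *)
Lemma det_degree_rank1_pencil r n A0 (u : I -> 'cV[k]_n) v : uniq r ->
  det_degree dv (rank1_pencil r A0 u v) (linear_degree r A0 u v).
Proof.
elim: r n A0 u v => [|i r IHr] n A0 u v /=.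
  move=> _; rewrite /rank1_pencil big_nil addr0; apply: det_degree_map.
  have [w hw] := det_degree_exists (@field_skew k) dkM A0.
  by rewrite (det_degree_det dkM hw).
move=> /andP[ir uniq_r].
have [phi [G [GE Gemb phix phixi]]] := x_generic i.
have GC e := ratdeg_ext_const e GE.
set B := rank1_pencil r A0 u v.
(* As [i] does not occur in [r], the endomorphism fixes all the variables of [B]. *)
have GB : map_mx G B = B.
  apply/matrixP => a b; rewrite mxE /B /rank1_pencil mxE summxE !mxE.
  rewrite rmorphD Gemb rmorph_sum; congr (_ + _).
  rewrite big_seq_cond [RHS]big_seq_cond; apply: eq_bigr => l /andP[lr _].
  rewrite mxE [in RHS]mxE rmorphM; congr (_ * _).
    by rewrite GC phix //; apply: contraNneq ir => <-.
  by rewrite mxE Gemb.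
have xi0 : x i != 0 by apply: contraNneq phixi => ->; rewrite raddf0.
pose c := - (x i)^-1; pose y := j c%:P.
have c0 : c != 0 by rewrite oppr_eq0 skew_invr_neq0.
have phic : phi c != c.
  rewrite raddfN /= eqr_opp; apply: contraNneq phixi => E; apply/eqP.
  have phixi0 : phi (x i) != 0 by rewrite raddf_eq0 //; apply: skew_rmorph_inj F_field.
  rewrite -[phi (x i)]mulr1 -(skew_mulVf F_field xi0) -E mulrA -rmorphM.
  by rewrite skew_mulfV // rmorph1 mul1r.
have yV : y^-1 = - j (x i)%:P.
  have jc : y \is a GRing.unit.
    by apply/D_field/frac_emb_neq0; [exact: sf_inj Dj | rewrite polyC_eq0].
  apply: (mulrI jc); rewrite mulrV // mulrN -rmorphM -polyCM /c mulNr skew_mulVf //.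
  by rewrite polyCN rmorphN !rmorph1 opprK.
have y0 : y != 0 by apply: frac_emb_neq0; [exact: sf_inj Dj | rewrite polyC_eq0].
have dvy : dv y = 0 by apply: ratdeg_const.
pose U := map_mx emb (u i); pose V := map_mx emb (v i).
(* The Schur complement at [y] is [B + U x_i V], and [x_i] commutes with the entries of [U]. *)
have EM : rank1_pencil (i :: r) A0 u v = B - U *m (y^-1)%:M *m V.
  rewrite /rank1_pencil big_cons addrCA addrC; congr (_ + _).
  rewrite yV map_mxM raddfN /= mulmxN mulNmx opprK.
  apply/matrixP => a b; rewrite mxE -mulmxA mul_scalar_mx !mxE !big_ord1 !mxE.
  by rewrite !mulrA x_comm.
have [w hw] := det_degree_exists D_field dvM (rank1_pencil (i :: r) A0 u v).
have hborder : det_degree dv (border_mx y U V B) w.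
  rewrite -[w]degree_add0l -[Some 0](_ : skew_degree dv y = _).
    by apply: det_degree_border_corner => //; rewrite -EM.
  by rewrite /skew_degree (negPf y0) dvy.
have h0 := IHr _ (border_mx 0 (u i) (v i) A0) (fun l => col_mx (0 : 'M_1) (u l))
  (fun l => row_mx (0 : 'M_1) (v l)) uniq_r.
rewrite rank1_pencil_border in h0.
have Gmap m1 m2 (N : 'M[k]_(m1, m2)) : map_mx G (map_mx emb N) = map_mx emb N.
  by apply/matrixP => a b; rewrite !mxE Gemb.
rewrite -(det_degree_uniq D_field hborder (det_degree_border D_field dvM _ (IHr _ _ _ _ uniq_r) h0)) //.
move=> B'; rewrite -/B => BB' B'B; apply: (ratdeg_shift F_field Dj GE phic).
(* An inverse of a fixed matrix is fixed, by uniqueness of the inverse. Hence [v B^-1 u] is fixed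
   while [y] is moved, and [ratdeg_shift] applies. *)
have GB' : map_mx G B' = B'.
  have GB'B : map_mx G B' *m B = 1%:M by rewrite -{1}GB -map_mxM B'B map_mx1.
  by rewrite -[LHS]mulmx1 -BB' mulmxA GB'B mul1mx.
rewrite raddfN /=; congr (- _).
transitivity (map_mx G (V *m B' *m U) 0 0); first by rewrite [RHS]mxE.
by rewrite !map_mxM GB' !Gmap.
Qed.
End LinearDegree.

(** * Instances: commutative fractions, the Dieudonne degree, and linear matrices over [F(t)] *)

Local Notation tofrac := FracField.tofrac.

Lemma tofrac_surj (R : idomainType) (d : {fraction R}) :
  exists p q : R, q != 0 /\ d = tofrac p / tofrac q.
Proof.
elim/quotW: d => r; exists (frac r).1, (frac r).2.
have d0 := denom_ratioP r; split=> //.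
have td0 : tofrac (frac r).2 != 0 by rewrite tofrac_eq0.
apply: (mulIf td0); rewrite divfK //.
rewrite -[_ * _]/(FracField.mul _ _) !piE; apply/eqmodP.
rewrite /= FracField.equivfE /FracField.mulf !numden_Ratio ?mulf_neq0 ?oner_neq0 //.
by rewrite !mulr1 mulrC.
Qed.

Lemma tofrac_inj (R : idomainType) : injective (@tofrac R).
Proof. by move=> p q /eqP; rewrite tofrac_eq => /eqP. Qed.

Lemma tofrac_skew_fractions (k : fieldType) : skew_fractions (@tofrac {poly k}).
Proof.
split; [exact: field_skew | exact: tofrac_inj | exact: tofrac_surj].
Qed.

(** [epsilon] picks some element of the coset. Its sign and its commutators have degree 0, so its
    degree comes from the diagonal of some decomposition, and by [bruhat_degree_uniq] all
    decompositions agree. *)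
Lemma deg_Dieudonne_det_degree (F : unitRingType) (F_field : GRing.field_axiom F)
    (D : unitRingType) (j : {rmorphism {poly F} -> D}) (Dj : skew_fractions j)
    n (M : 'M[D]_n) w :
  det_degree (ratdeg_int j) M w -> deg_Dieudonne j M = w.
Proof.
move=> hw; rewrite /deg_Dieudonne; have D_field := sf_skew_field Dj.
have dvM := ratdeg_intM F_field Dj.
case: excluded_middle_informative => [M_unit|nM]; last first.
  by case: w hw => [w hw|//]; case: nM; apply: bruhat_degree_unit hw.
case: w hw => [w hw|/left_singular_nonsingular//].
have ex_det : exists e, Dieudonne_det M e.
  have [L [d [s [U [hL hU hd EM _]]]]] := hw.
  exists ((-1) ^+ s * (\prod_(i < n) d 0 i) * 1), L, U, d, s, 1.
  by split=> //; split=> //; constructor.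
have := epsilon_spec (inhabits 0) _ ex_det; set e := epsilon _ _.
move=> [L [U [d [s [c [hL hU hd EM [hc ->]]]]]]].
rewrite ratdegE //; rewrite /skew_degree.
have prod_deg (r : seq 'I_n) : \prod_(i <- r) d 0 i != 0 /\
    ratdeg_int j (\prod_(i <- r) d 0 i) = \sum_(i <- r) ratdeg_int j (d 0 i).
  elim: r => [|i r [IH0 IHr]]; first by rewrite !big_nil oner_neq0 (dv1 dvM).
  by rewrite !big_cons skew_mulf_neq0 // dvM // IHr.
have comm_deg : c != 0 /\ ratdeg_int j c = 0.
  elim: hc => [|x y c' ux uy _ [c'0 IHc]]; first by rewrite oner_neq0 (dv1 dvM).
  have unit_neq0 (z : D) : z \is a GRing.unit -> z != 0.
    by apply: contraTneq => ->; rewrite unitr0.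
  have [x0 y0] := (unit_neq0 _ ux, unit_neq0 _ uy).
  have [x'0 y'0] := (skew_invr_neq0 D_field x0, skew_invr_neq0 D_field y0).
  have nz := skew_mulf_neq0 D_field; split; first by rewrite !nz.
  rewrite !dvM ?nz //.
  by rewrite !(dvV D_field dvM) // IHc addr0 addrAC addrK subrr.
have sgn_deg : (-1) ^+ odd_perm s != 0 :> D /\ ratdeg_int j ((-1) ^+ odd_perm s) = 0.
  by case: (odd_perm s); rewrite ?oppr_eq0 oner_neq0 ?(dvN1 dvM) ?(dv1 dvM).
have [[c0 dc] [s0 ds] [p0 dp]] := And3 comm_deg sgn_deg (prod_deg (index_enum _)).
rewrite ifN ?skew_mulf_neq0 // !dvM ?skew_mulf_neq0 // dc ds dp add0r addr0.
congr Some; apply: bruhat_degree_uniq hw.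
by exists L, d, s, U; split.
Qed.

Section Pencil.
Variables (K : fieldType) (R : lalgType K) (F : unitRingType) (f : {rmorphism R -> F}).
Hypotheses (F_field : GRing.field_axiom F).
Variables (D : unitRingType) (j : {rmorphism {poly F} -> D}).
Hypothesis Dj : skew_fractions j.

(** [ratemb] evaluates a representative chosen by [epsilon]; the morphism given by [frac_extend] has
    the same value on every representative. *)
Lemma ratemb_rmorph : exists emb : {rmorphism {fraction {poly K}} -> D},
  (forall p q, q != 0 -> emb (tofrac p / tofrac q)
     = j (map_poly (f \o in_alg R) p) / j (map_poly (f \o in_alg R) q)) /\
  ratemb f j =1 emb.
Proof.
have D_field := sf_skew_field Dj.
have g_inj : injective (j \o map_poly (f \o in_alg R)).
  apply: inj_comp; first exact: sf_inj Dj.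
  apply: map_inj_poly (raddf0 _); exact: skew_rmorph_inj (@field_skew K).
have [emb embE] := frac_extend (@field_skew _) (@tofrac_inj {poly K})
  (@tofrac_surj _) D_field g_inj.
exists emb; split=> // a; rewrite /ratemb.
have [] := numdenP (tofrac_skew_fractions K) a.
by case: (numden _ a) => p q /= q0 ->; rewrite embE.
Qed.

Lemma det_degree_linear_mx m (x : 'I_m -> R) n (A0 : 'M[{fraction {poly K}}]_n) u v :
  (forall i (c : K), x i * c%:A = c%:A * x i) ->
  (forall i, exists phi : {rmorphism F -> F},
     [/\ forall c : K, phi (f c%:A) = f c%:A,
         forall l, l != i -> phi (f (x l)) = f (x l) &
         phi (f (x i)) != f (x i)]) ->
  det_degree (ratdeg_int j) (linear_mx f j x A0 (fun i => u i *m v i))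
    (linear_degree (ratdeg_int (@tofrac {poly K})) (index_enum 'I_m) A0 u v).
Proof.
move=> x_comm x_generic; have D_field := sf_skew_field Dj.
have [emb [embE Eemb]] := ratemb_rmorph.
have K_frac := tofrac_skew_fractions K.
have map_neq0 (p : {poly K}) : p != 0 -> map_poly (f \o in_alg R) p != 0.
  by rewrite -!size_poly_gt0 (skew_size_map (@field_skew K)).
have map_ratemb n1 n2 (M : 'M_(n1, n2)) : map_mx (ratemb f j) M = map_mx emb M.
  by apply/matrixP => a b; rewrite !mxE Eemb.
have -> : linear_mx f j x A0 (fun i => u i *m v i)
    = rank1_pencil j emb (f \o x) (index_enum 'I_m) A0 u v.
  rewrite /linear_mx map_ratemb; congr (_ + _).
  by apply: eq_bigr => i _; rewrite map_ratemb.
apply: det_degree_rank1_pencil => //.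
- by have h := ratdeg_intM (@field_skew K) K_frac; exact h.
- move=> a; have [p [q [q0 ->]]] := tofrac_surj a.
  rewrite (frac_eq0 K_frac) // => p0; rewrite embE // !ratdeg_frac ?map_neq0 //;
    last exact: field_skew.
  by rewrite !(skew_size_map (@field_skew K)).
- move=> i a; have [p [q [q0 ->]]] := tofrac_surj a; rewrite embE //.
  have comm_p (r : {poly K}) :
      GRing.comm (j (f (x i))%:P) (j (map_poly (f \o in_alg R) r)).
    rewrite /GRing.comm -!rmorphM; congr (j _); apply/polyP => l.
    by rewrite coefCM coefMC coef_map /= -!rmorphM x_comm.
  by apply: commrM; [exact: comm_p | apply: commrV].
(* Acting on coefficients, [phi] extends to an endomorphism of [F(t)]; it fixes [K(t)] because [phi]
   fixes the image of [K]. *)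
- move=> i; have [phi [phiK phix phixi]] := x_generic i.
  have g_inj : injective (j \o map_poly phi).
    apply: inj_comp; first exact: sf_inj Dj.
    apply: map_inj_poly (raddf0 _); exact: skew_rmorph_inj F_field.
  have [G GE] := frac_extend D_field (sf_inj Dj) (sf_surj Dj) D_field g_inj.
  exists phi, G; split=> // a; have [p [q [q0 ->]]] := tofrac_surj a.
  rewrite embE // GE ?map_neq0 //=.
  by rewrite -!map_poly_comp; congr (j _ / j _); apply: eq_map_poly => c /=.
- exact: index_enum_uniq.
Qed.

End Pencil.

(** * Involutions that move a single variable *)

(** Composing a specialization of [f \o sigma] with itself gives the identity on
    a subring closed under division, which is everything because [f] is epic. *)
Lemma universal_field_involution (R : nzRingType) (F : unitRingType)
    (f : {rmorphism R -> F}) (sigma : {rmorphism R -> R}) :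
  universal_field_of_fractions f -> involutive sigma ->
  exists phi : {rmorphism F -> F}, forall r, phi (f r) = f (sigma r).
Proof.
move=> [[F_field f_gen] f_inj f_univ] sigmaK.
(* [f \o sigma] is again epic, because [sigma] is onto; universality of [f] then specializes [f] to
   it. *)
have [|S [phi [[S1 SB SM] Sf phiB phiM phif phi_local]]] := f_univ F (f \o sigma).
  split=> // T T_closed Tf; apply: f_gen => // r; rewrite -[r]sigmaK; exact: Tf.
have S0 : 0 \in S by rewrite -(subrr 1) SB.
have phi1 : phi 1 = 1 by rewrite -(rmorph1 f) phif /= !rmorph1.
have phi0 : phi 0 = 0 by rewrite -(raddf0 f) phif /= !raddf0.
have phiV x : x \in S -> phi x != 0 -> phi x^-1 = (phi x)^-1.
  move=> xS px0; have x0 : x != 0 by apply: contraNneq px0 => ->; rewrite phi0.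
  have ux := F_field _ px0; apply: (mulIr ux); rewrite mulVr //.
  by rewrite -phiM ?phi_local // skew_mulVf.
pose T : {pred F} := [pred z | [&& z \in S, phi z \in S & phi (phi z) == z]].
have T_all z : z \in T.
  apply: f_gen => [|r]; last by rewrite inE !phif /= !Sf sigmaK eqxx.
  split.
  - by rewrite inE !phi1 S1 eqxx.
  - move=> x y; rewrite !inE => /and3P[xS pxS /eqP ppx] /and3P[yS pyS /eqP ppy].
    by rewrite !phiB // ppx ppy !SB // eqxx.
  - move=> x y; rewrite !inE => /and3P[xS pxS /eqP ppx] /and3P[yS pyS /eqP ppy].
    have [->|y0] := eqVneq y 0; first by rewrite invr0 mulr0 !phi0 S0 eqxx.
    (* [phi y] and [phi (phi y) = y] are both nonzero, so locality puts [y^-1] and [(phi y)^-1] into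
       [S]. *)
    have py0 : phi y != 0 by apply: contraNneq y0 => py; rewrite -ppy py phi0.
    have yVS := phi_local _ yS py0.
    have pyVS : (phi y)^-1 \in S by apply: phi_local; rewrite ?ppy.
    by rewrite !phiM ?phiV ?ppy ?ppx // ?SM ?eqxx.
have S_all z : z \in S by have /and3P[] := T_all z.
have phi_sub : zmod_morphism phi by move=> x y; rewrite phiB.
have phi_mon : monoid_morphism phi by split=> // x y; rewrite phiM.
pose pa := GRing.isZmodMorphism.Build _ _ phi phi_sub.
pose pm := GRing.isMonoidMorphism.Build _ _ phi phi_mon.
pose phiR : {rmorphism F -> F} := HB.pack phi pa pm.
by exists phiR.
Qed.

Section FreeRing.
Variables (K : fieldType) (m : nat).
Local Notation R := (free_ring K m).
Local Notation x := (@free_var K m).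

Lemma free_ring_scalarE (c : K) : (c%:A : R) = mkmalgU (mone : {fmonom 'I_m}) c.
Proof. by rewrite -mul_malgC mulr1. Qed.

Lemma free_ring_scalarC (c : K) (g : R) : g * c%:A = c%:A * g.
Proof.
rewrite free_ring_scalarE [g]monalgE mulr_suml mulr_sumr; apply: eq_bigr => k _.
by rewrite !malgM_def !fgmulUU mulm1 mul1m mulrC.
Qed.

(** A word is sent to the product of the images of its letters; the linear extension is
    multiplicative because scalars are central. *)
Lemma free_ring_lift (y : 'I_m -> R) : exists sigma : {rmorphism R -> R},
  (forall c : K, sigma c%:A = c%:A) /\ forall i, sigma (x i) = y i.
Proof.
pose h (w : {fmonom 'I_m}) : R := \prod_(i <- (w : seq _)) y i.
have h_morph : mmorphism h.
  split=> [w w'|]; first by rewrite /h fmM big_cat.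
  by rewrite /h fm1 big_nil.
pose hm : {mmorphism {fmonom 'I_m} -> R} := HB.pack h (isMultiplicative.Build _ _ h h_morph).
pose C : {rmorphism K -> R} := [the {rmorphism K -> R} of in_alg R].
have sM : monoid_morphism (monalg.mmap C hm).
  have [|sM s1] := @monalg.commr_mmap_is_multiplicative _ _ _ C hm.
    by move=> g w w'; rewrite /GRing.comm /= free_ring_scalarC.
  by split.
pose s : {rmorphism R -> R} := HB.pack (monalg.mmap C hm)
  (GRing.isMonoidMorphism.Build _ _ (monalg.mmap C hm) sM).
exists s; split=> [c|i] /=; first by rewrite {1}free_ring_scalarE mmapU /= /h fm1 big_nil mulr1.
by rewrite /free_var mmapU /= scale1r mul1r /h fmU big_seq1.
Qed.

Lemma free_ring_rmorph_id (sigma : {rmorphism R -> R}) :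
  (forall c : K, sigma c%:A = c%:A) -> (forall i, sigma (x i) = x i) -> sigma =1 id.
Proof.
move=> sC sx g; rewrite [g]monalgE rmorph_sum; apply: eq_bigr => w _ /=.
have -> (c : K) : mkmalgU w c = c%:A * \prod_(i <- (w : seq _)) x i :> R.
  rewrite free_ring_scalarE mul_malgC.
  have -> : \prod_(i <- (w : seq _)) x i = mkmalgU w 1.
    case: w => w /=; elim: w => [|i w IHw].
      by rewrite big_nil -fmoneE.
    rewrite big_cons IHw malgM_def fgmulUU mulr1; congr mkmalgU.
    by apply/eqP; rewrite fmP fmM fmU.
  by apply/malgP => w'; rewrite monalg.mcoeffZ !mcoeffU mulr_natr.
by rewrite rmorphM sC rmorph_prod; congr (_ * _); apply: eq_bigr => i _.
Qed.

(** It suffices to check the involution on the variables. Unlike [- x_i], the image [1 - x_i]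
    differs from [x_i] also in characteristic 2. *)
Lemma free_ring_flip (i : 'I_m) : exists sigma : {rmorphism R -> R},
  [/\ involutive sigma, forall c : K, sigma c%:A = c%:A,
      forall l, l != i -> sigma (x l) = x l & sigma (x i) = 1 - x i].
Proof.
have [s [sC sx]] := free_ring_lift (fun l => if l == i then 1 - x l else x l).
exists s; split=> //; last by rewrite sx eqxx.
  apply: (@free_ring_rmorph_id (s \o s)) => [c|l] /=; first by rewrite !sC.
  rewrite sx; case: eqP => [->|/eqP/negPf li]; last by rewrite sx li.
  by rewrite rmorphB rmorph1 sx eqxx subKr.
by move=> l /negPf li; rewrite sx li.
Qed.

Lemma free_var_flip_neq i : 1 - x i != x i.
Proof.
rewrite subr_eq -[1]scale1r free_ring_scalarE.
(* The constant coefficients of [1] and [x i + x i] are 1 and 0. *)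
apply/eqP => /(congr1 (monalg.mcoeff (mone : {fmonom 'I_m})))/eqP.
have -> : monalg.mcoeff (mone : {fmonom 'I_m}) (x i + x i) = 0.
  rewrite raddfD /= !mcoeffU (_ : fmu i == mone = false) ?mulr0n ?addr0 //.
  by rewrite fmP fmU fm1.
by rewrite mcoeffUU oner_eq0.
Qed.

End FreeRing.

Section PolyRing.
Variables (K : fieldType) (m : nat).
Local Notation R := (mpoly m K).

Lemma mpoly_rmorph_id (sigma : {rmorphism R -> R}) :
  (forall c : K, sigma c%:A = c%:A) -> (forall i, sigma 'X_i = 'X_i) -> sigma =1 id.
Proof.
move=> sC sx p; rewrite [p]mpolyE rmorph_sum; apply: eq_bigr => w _ /=.
rewrite -mul_mpolyC -alg_mpolyC rmorphM sC; congr (_ * _).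
rewrite mpolyXE_id rmorph_prod; apply: eq_bigr => i _.
by rewrite rmorphXn sx.
Qed.

Lemma mpoly_flip (i : 'I_m) : exists sigma : {rmorphism R -> R},
  [/\ involutive sigma, forall c : K, sigma c%:A = c%:A,
      forall l, l != i -> sigma 'X_l = 'X_l & sigma 'X_i = 1 - 'X_i].
Proof.
pose lq := [tuple if l == i then 1 - 'X_l else 'X_l : R | l < m].
pose s : {rmorphism R -> R} := [the {rmorphism R -> R} of comp_mpoly lq].
have sC (c : K) : s c%:A = c%:A by rewrite alg_mpolyC /= comp_mpolyC.
have sx l : s 'X_l = if l == i then 1 - 'X_l else 'X_l.
  by rewrite /= comp_mpolyXU -tnth_nth tnth_mktuple.
exists s; split=> //; last by rewrite sx eqxx.
  apply: (@mpoly_rmorph_id (s \o s)) => [c|l]; first by rewrite [LHS]/= !sC.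
  rewrite [LHS]/= sx; case: eqP => [->|/eqP/negPf li]; last by rewrite sx li.
  by rewrite rmorphB rmorph1 sx eqxx subKr.
by move=> l /negPf li; rewrite sx li.
Qed.

Lemma mpolyX_flip_neq (i : 'I_m) : 1 - 'X_i != 'X_i :> R.
Proof.
rewrite subr_eq; apply/eqP => /(congr1 (mcoeff 0%MM))/eqP.
by rewrite mcoeffD mcoeffX mcoeff1 eqxx mnm1_eq0 addr0 oner_eq0.
Qed.

Lemma fraction_involution (sigma : {rmorphism R -> R}) : involutive sigma ->
  exists phi : {rmorphism {fraction R} -> {fraction R}},
    forall r, phi (tofrac r) = tofrac (sigma r).
Proof.
move=> sK; have g_inj : injective (@tofrac R \o sigma).
  exact: inj_comp (@tofrac_inj _) (can_inj sK).
have [phi phiE] := frac_extend (@field_skew _) (@tofrac_inj R) (@tofrac_surj _)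
  (@field_skew _) g_inj.
exists phi => r; rewrite -[tofrac r]divr1 -(rmorph1 (@tofrac R)) phiE ?oner_neq0 //=.
by rewrite !rmorph1 divr1.
Qed.

End PolyRing.

Lemma rank1_factor (k : fieldType) m n (A : 'M[k]_(m, n)) : \rank A = 1%N ->
  exists (u : 'cV[k]_m) (v : 'rV[k]_n), A = u *m v.
Proof.
move=> rA; move: (col_base A) (row_base A) (mulmx_base A); rewrite rA => u v <-.
by exists u, v.
Qed.

Theorem theorem5p2 (K : fieldType) (m n : nat)
    (F : unitRingType) (f : {rmorphism free_ring K m -> F})
    (Ff : universal_field_of_fractions f)
    (D : unitRingType) (j : {rmorphism {poly F} -> D})
    (Dj : skew_fractions j)
    (A0 : 'M[{fraction {poly K}}]_n)
    (A : 'I_m -> 'M[{fraction {poly K}}]_n)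
    (A_rank1 : forall i, \rank (A i) = 1%N) :
  deg_det A0 A = deg_Det f j A0 A.
Proof.
have F_field : GRing.field_axiom F by have [[]] := Ff.
have f_inj := uff_inj Ff.
have ex_uv i : {uv : 'cV_n * 'rV_n | A i = uv.1 *m uv.2}.
  apply: constructive_indefinite_description.
  by have [u [v ->]] := rank1_factor (A_rank1 i); exists (u, v).
pose u i := (sval (ex_uv i)).1; pose v i := (sval (ex_uv i)).2.
have EA i : A i = u i *m v i by rewrite /u /v; case: (ex_uv i).
have linear_mxE (R : lalgType K) (E E' : unitRingType) (g : R -> E) (h : {poly E} -> E') x :
    linear_mx g h x A0 A = linear_mx g h x A0 (fun i => u i *m v i).
  by congr (_ + _); apply: eq_bigr => i _; rewrite EA.
(* The common value of both sides, computed over [K(t)]. *)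
pose w := linear_degree (ratdeg_int (@tofrac {poly K})) (index_enum 'I_m) A0 u v.
transitivity w; last first.
  symmetry; apply: deg_Dieudonne_det_degree => //; rewrite linear_mxE.
  apply: det_degree_linear_mx => // [i c|i]; first exact: free_ring_scalarC.
  have [s [sK sC sx sxi]] := free_ring_flip K i.
  have [phi phiE] := universal_field_involution Ff sK.
  exists phi; split=> [c|l li|]; rewrite phiE ?sC ?sxi ?sx //.
  by rewrite (inj_eq f_inj) free_var_flip_neq.
have Lf := @field_skew {fraction mpoly m K}.
have Lj := tofrac_skew_fractions {fraction mpoly m K}.
(* The same pencil lemma is applied with [K(x_1, ..., x_m)] as the skew field; there the degree is
   that of the ordinary determinant. *)
rewrite /deg_det ratdegE //; apply: (det_degree_det (ratdeg_intM Lf Lj)).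
rewrite linear_mxE.
apply: (@det_degree_linear_mx K (mpoly m K) _ (@tofrac (mpoly m K)) Lf _ _ Lj).
  by move=> i c; rewrite mulrC.
move=> i; have [s [sK sC sx sxi]] := mpoly_flip K i.
have [phi phiE] := fraction_involution sK.
exists phi; split=> [c|l li|]; rewrite phiE ?sC ?sxi ?sx //.
by rewrite (inj_eq (@tofrac_inj _)) mpolyX_flip_neq.
Qed.
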